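(* Over an algebraically closed field of characteristic $2$, every square matrix is congruent to a direct sum, determined uniquely up to permutation of summands, of matrices of the form: (i) $J_n(0)$; (ii) $\begin{bmatrix}0&I_n\\ J_n(\lambda)&0\end{bmatrix}$, in which $\lambda$ is nonzero and is determined up to replacement by $\lambda^{-1}$; (iii) $\sqrt[T]{J_{n}(1)}$ with odd $n$; no blocks of the form $\begin{bmatrix}0&I_n\\ J_n(1)&0\end{bmatrix}$ are permitted for any odd $n$ for which a block $\sqrt[T]{J_{n}(1)}$ occurs in the direct sum. Instead of the matrix (iii), one may use $\Gamma'_n$ or any other nonsingular matrix whose cosquare is similar to $J_n(1)$; these matrices are congruent to (iii).
   Context: Matrices $A,B$ are congruent if $S^TAS=B$ for some nonsingular $S$. $J_n(\lambda)$ is the $n\times n$ upper triangular Jordan block with eigenvalue $\lambda$. The cosquare of a nonsingular matrix $A$ is $A^{-T}A$; if $\Phi$ is a cosquare, $\sqrt[T]{\Phi}$ denotes any fixed chosen matrix $C$ with $C^{-T}C=\Phi$. For odd $n$, $\Gamma'_n$ is the $n\times n$ matrix whose $(i,n+1-i)$ entry is $1$ for all $i$, whose $(i,n+2-i)$ entry is $1$ for $i>(n+1)/2$ and $0$ for $2\le i\le (n+1)/2$, and all other entries are $0$. (If the direct sum would otherwise contain both $\sqrt[T]{J_{n}(1)}$ and $\begin{bmatrix}0&I_n\\ J_n(1)&0\end{bmatrix}$ for the same odd $n$, this pair is replaced by three blocks $\sqrt[T]{J_{n}(1)}$, since these are congruent.) *)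

(* Defs.v *)
From HB Require Import structures.
From mathcomp Require Import all_boot all_order all_algebra.
From Stdlib Require List Permutation.
Set Implicit Arguments.
Unset Strict Implicit.
Unset Printing Implicit Defensive.
Import GRing.Theory.
Local Open Scope ring_scope.

Section Defs.
Variable F : fieldType.

Definition jordan (n : nat) (lam : F) : 'M[F]_n :=
  \matrix_(i < n, j < n) (if i == j :> nat then lam
                          else if j == i.+1 :> nat then 1 else 0).

Definition congruent n (A B : 'M[F]_n) : Prop :=
  exists S : 'M[F]_n, S \in unitmx /\ S^T *m A *m S = B.

Definition similar n (A B : 'M[F]_n) : Prop :=
  exists P : 'M[F]_n, P \in unitmx /\ invmx P *m A *m P = B.

Definition cosquare n (A : 'M[F]_n) : 'M[F]_n := invmx (A^T) *m A.

Definition sqrtT_like n (A : 'M[F]_n) : Prop :=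
  A \in unitmx /\ similar (cosquare A) (jordan n 1).

Definition Gamma' (n : nat) : 'M[F]_n :=
  \matrix_(i < n, j < n)
    (if (i + j == n.-1)%N || (((n.+1)./2 <= i)%N && (i + j == n)%N) then 1 else 0).

Inductive blk : Type :=
  | BJ0 of nat
  | BPair of nat & F
  | BSq of nat.

Definition bsz (b : blk) : nat :=
  match b with BJ0 n => n | BPair n _ => (n + n)%N | BSq n => n end.

Definition total_size (l : seq blk) : nat := sumn (map bsz l).

(* Matrix of a block; S n is the chosen matrix used for sqrt^T(J_n(1)). *)
Definition bmx (S : forall n, 'M[F]_n) (b : blk) : 'M[F]_(bsz b) :=
  match b return 'M[F]_(bsz b) with
  | BJ0 n => jordan n 0
  | BPair n lam => block_mx 0 1%:M (jordan n lam) 0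
  | BSq n => S n
  end.

Fixpoint dsum (S : forall n, 'M[F]_n) (l : seq blk) : 'M[F]_(total_size l) :=
  match l return 'M[F]_(total_size l) with
  | [::] => 0
  | b :: l' => block_mx (bmx S b) 0 0 (dsum S l')
  end.

Definition blk_ok (b : blk) : Prop :=
  match b with
  | BJ0 n => (0 < n)%N
  | BPair n lam => (0 < n)%N /\ lam != 0
  | BSq n => (0 < n)%N /\ odd n
  end.

Definition admissible (l : seq blk) : Prop :=
  (forall b, List.In b l -> blk_ok b) /\
  (forall n, odd n -> List.In (BSq n) l -> ~ List.In (BPair n 1) l).

Definition blk_equiv (b b' : blk) : Prop :=
  match b, b' with
  | BJ0 n, BJ0 m => n = m
  | BPair n lam, BPair m mu => n = m /\ (mu = lam \/ mu = lam^-1)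
  | BSq n, BSq m => n = m
  | _, _ => False
  end.

Definition blocks_equiv (l1 l2 : seq blk) : Prop :=
  exists l, List.Forall2 blk_equiv l1 l /\ Permutation.Permutation l l2.

End Defs.

(* Main.v *)
Require Import Defs.
From HB Require Import structures.
From mathcomp Require Import all_boot all_order all_algebra.
From mathcomp Require Import ring zify.
From Stdlib Require List Permutation.
Set Implicit Arguments.
Unset Strict Implicit.
Unset Printing Implicit Defensive.
Import GRing.Theory.
Local Open Scope ring_scope.

(* Regularization.  Let L be the left radical of a bilinear form A and P the
   left orthogonal of L.  Then A induces a form B on P / L, and A is determined
   up to congruence by B, dim L and codim P.  Passing from A to B turns J_n(0)
   into J_(n-2)(0) and fixes nonsingular forms, so that existence and uniqueness
   of the singular part follow by induction on the size.

   Nonsingular forms.  Let M be the cosquare acting on rows, so that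
   A(x, y) = A(y M, x).  A nonsingular M-stable subspace splits off.  For an
   eigenvalue lam <> 1, a vector at the top of ker (M - lam)^k and one dual to it
   in ker (M^-1 - lam)^k span a block (ii).  If N = M - 1 is nilpotent of index
   k, put s = M + M^-1 and Q_i(x) = A(x s^i, x), quadratic forms with polar
   A(x s^i N, y); they determine the form on the cyclic module generated by x.
   If k = 2m + 1 and Q_m <> 0, then some x satisfies Q_i(x) = [i = m] for all i
   and generates a block (iii).  In the other cases two cyclic vectors dual to
   each other can be modified successively so that all Q_i vanish on them, and
   they span a block (ii).  If a, b, c generate three orthogonal copies of one
   block (iii), then a + c and b + c generate a block (ii) with eigenvalue 1;
   hence a block (iii) together with that block (ii) is three blocks (iii).

   Uniqueness for nonsingular forms.  The ranks of the powers of M - lam count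
   the Jordan blocks of M, and for k = 2m + 1 a block (iii) of size k occurs if
   and only if x |-> A(x N^(2m), x) is not zero on ker N^k. *)

(** * Congruence across sizes and its compatibility with direct sums *)

Section HeteroCongruence.
Variable F : fieldType.

(* Congruence between square matrices whose sizes are only propositionally
   equal; it avoids casts along [total_size] equations. *)
Definition hcong m n (A : 'M[F]_m) (B : 'M[F]_n) : Prop :=
  m = n /\ exists2 X : 'M[F]_(n, m), row_free X & X *m A *m X^T = B.

Lemma hcong_refl n (A : 'M[F]_n) : hcong A A.
Proof.
by split=> //; exists 1%:M; rewrite ?row_free_unit ?unitmx1 // trmx1 mul1mx mulmx1.
Qed.

Lemma hcong_trans m n p (A : 'M[F]_m) (B : 'M[F]_n) (C : 'M[F]_p) :
  hcong A B -> hcong B C -> hcong A C.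
Proof.
case=> e [X Xf <-] [e' [Y Yf <-]]; subst m; subst n; split=> //; exists (Y *m X).
  by rewrite /row_free mxrankMfree.
by rewrite trmx_mul !mulmxA.
Qed.

Lemma hcong_sym m n (A : 'M[F]_m) (B : 'M[F]_n) : hcong A B -> hcong B A.
Proof.
case=> e; move: B; case: n / e => B [X Xf <-]; split=> //.
rewrite row_free_unit in Xf; exists (invmx X).
  by rewrite row_free_unit unitmx_inv.
rewrite trmx_inv !mulmxA mulVmx // mul1mx -mulmxA mulmxV ?mulmx1 //.
by rewrite unitmx_tr.
Qed.

Lemma hcongP n (A B : 'M[F]_n) : congruent A B <-> hcong A B.
Proof.
split.
  case=> S [Su <-]; split=> //; exists S^T; last by rewrite trmxK.
  by rewrite row_free_unit unitmx_tr.
case=> _ [X Xf <-]; exists X^T; rewrite trmxK unitmx_tr -row_free_unit.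
by split.
Qed.

Lemma hcong_castmx m n (e : m = n) (A : 'M[F]_m) (B : 'M[F]_n) :
  congruent (castmx (e, e) A) B <-> hcong A B.
Proof.
by move: B; case: n / e => B; rewrite castmx_id; apply: hcongP.
Qed.

Lemma hcong_size m n (A : 'M[F]_m) (B : 'M[F]_n) : hcong A B -> m = n.
Proof. by case. Qed.

Lemma hcong_rank m n (A : 'M[F]_m) (B : 'M[F]_n) : hcong A B -> \rank A = \rank B.
Proof.
case=> e; move: B; case: n / e => B [X Xf <-].
rewrite row_free_unit in Xf.
by rewrite mxrankMfree ?row_free_unit ?unitmx_tr // eqmxMfull // row_full_unit.
Qed.

Lemma hcong_unit m n (A : 'M[F]_m) (B : 'M[F]_n) :
  hcong A B -> A \in unitmx -> B \in unitmx.
Proof.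
by move=> AB; rewrite -!row_free_unit /row_free -(hcong_rank AB) -(hcong_size AB).
Qed.

Definition dsum2 m n (A : 'M[F]_m) (B : 'M[F]_n) : 'M[F]_(m + n) :=
  block_mx A 0 0 B.

Lemma dsum2_unit m n (A : 'M[F]_m) (B : 'M[F]_n) :
  (dsum2 A B \in unitmx) = (A \in unitmx) && (B \in unitmx).
Proof. exact: block_diag_mx_unit. Qed.

Lemma mul_dsum2 m n (A A' : 'M[F]_m) (B B' : 'M[F]_n) :
  dsum2 A B *m dsum2 A' B' = dsum2 (A *m A') (B *m B').
Proof. by rewrite mulmx_block !mulmx0 !mul0mx !addr0 !add0r. Qed.

Lemma tr_dsum2 m n (A : 'M[F]_m) (B : 'M[F]_n) : (dsum2 A B)^T = dsum2 A^T B^T.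
Proof. by rewrite tr_block_mx !trmx0. Qed.

Lemma inv_dsum2 m n (A : 'M[F]_m) (B : 'M[F]_n) :
  A \in unitmx -> B \in unitmx -> invmx (dsum2 A B) = dsum2 (invmx A) (invmx B).
Proof. by move=> Au Bu; apply: invmx_block_diag; rewrite dsum2_unit Au. Qed.

Lemma hcong_dsum2 m n m' n' (A : 'M[F]_m) (B : 'M[F]_n) (A' : 'M[F]_m')
    (B' : 'M[F]_n') :
  hcong A A' -> hcong B B' -> hcong (dsum2 A B) (dsum2 A' B').
Proof.
case=> e [X Xf <-] [e' [Y Yf <-]]; subst m; subst n; split=> //.
exists (block_mx X 0 0 Y).
  by rewrite /row_free rank_diag_block_mx (eqP Xf) (eqP Yf).
by rewrite tr_block_mx !mulmx_block !trmx0 !mulmx0 !mul0mx !addr0 !add0r !mul0mx.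
Qed.

Lemma hcong_dsum2C m n (A : 'M[F]_m) (B : 'M[F]_n) :
  hcong (dsum2 A B) (dsum2 B A).
Proof.
split; first by rewrite addnC.
exists (block_mx 0 1%:M 1%:M 0); last first.
  rewrite tr_block_mx !mulmx_block !trmx0 !trmx1.
  by rewrite !mulmx0 !mul0mx !mulmx1 !mul1mx !addr0 !add0r.
apply/row_freeP; exists (block_mx 0 1%:M 1%:M 0).
by rewrite mulmx_block !mulmx0 !mul0mx !mulmx1 !addr0 !add0r -scalar_mx_block.
Qed.

Lemma hcong_dsum2A m n p (A : 'M[F]_m) (B : 'M[F]_n) (C : 'M[F]_p) :
  hcong (dsum2 A (dsum2 B C)) (dsum2 (dsum2 A B) C).
Proof.
split; first by rewrite addnA.
have e := addnA m n p.
exists (castmx (e, erefl) 1%:M).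
  by rewrite row_free_castmx row_free_unit unitmx1.
have -> : dsum2 (dsum2 A B) C = castmx (e, e) (dsum2 A (dsum2 B C)).
  rewrite /dsum2; have := @block_mxA _ _ _ _ _ _ _ A 0 0 0 B 0 0 0 C.
  by rewrite /= !row_mx0 !col_mx0 => ->; rewrite castmx_comp castmx_id.
move: (dsum2 A (dsum2 B C)) => Z; move: e; move: (m + n + p)%N => q e.
by case: q / e; rewrite !castmx_id trmx1 mul1mx mulmx1.
Qed.

Lemma hcong_dsum2_0l m (A : 'M[F]_m) (Z : 'M[F]_0) : hcong (dsum2 Z A) A.
Proof.
split=> //; exists (row_mx (0 : 'M_(m, 0)) 1%:M).
  by apply/row_freeP; exists (col_mx 0 1%:M); rewrite mul_row_col mulmx1 mulmx0 add0r.
rewrite tr_row_mx mul_row_block mul_row_col.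
by rewrite ?trmx0 trmx1 !(mulmx0, mul0mx, mul1mx, mulmx1, add0r).
Qed.

Variable S : forall n, 'M[F]_n.

Lemma dsum_cat l1 l2 :
  hcong (dsum S (l1 ++ l2)) (dsum2 (dsum S l1) (dsum S l2)).
Proof.
elim: l1 => [|b l1 IH] /=; first by apply: hcong_sym; apply: hcong_dsum2_0l.
apply: hcong_trans (hcong_dsum2A _ _ _).
by apply: hcong_dsum2 => //; apply: hcong_refl.
Qed.

Lemma dsum_perm l1 l2 :
  Permutation.Permutation l1 l2 -> hcong (dsum S l1) (dsum S l2).
Proof.
elim=> {l1 l2} [|b l1 l2 _ IH|b c l|l1 l2 l3 _ IH1 _ IH2].
- exact: hcong_refl.
- by apply: hcong_dsum2 => //; apply: hcong_refl.
- apply: hcong_trans (hcong_dsum2A _ _ _) _.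
  apply: hcong_trans (hcong_sym (hcong_dsum2A _ _ _)).
  by apply: hcong_dsum2 (hcong_dsum2C _ _) (hcong_refl _).
- exact: hcong_trans IH1 IH2.
Qed.

End HeteroCongruence.

(** * Lists of blocks *)

Section BlockLists.
Variable F : fieldType.

Definition is_reg (b : blk F) := if b is BJ0 _ then false else true.
Definition is_pair (b : blk F) := if b is BPair _ _ then true else false.

Lemma has_In (T : Type) (p : pred T) l :
  has p l <-> exists2 b, List.In b l & p b.
Proof.
split.
  elim: l => //= b l IH /orP[pb|/IH[c cl pc]]; first by exists b; [left|].
  by exists c; [right|].
by case=> b + pb; elim: l => //= c l IH [->|/IH ->]; rewrite ?pb ?orbT.
Qed.

Lemma In_perm (T : Type) (b : T) l : List.In b l ->
  exists l', Permutation.Permutation l (b :: l').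
Proof.
move=> bl; have [l1 [l2 ->]] := List.in_split _ _ bl; exists (l1 ++ l2).
by apply: Permutation.Permutation_sym; apply: Permutation.Permutation_middle.
Qed.

End BlockLists.

(** * Regularization *)

Section Regularization.
Variable F : fieldType.

(* [L] spans the left radical of [A] and [W], [L] span its left orthogonal;
   [B] is the Gram matrix of [A] on the quotient. The primed matrices and [R],
   [R'] are one-sided inverses witnessing that the rows of [U], [W], [L] form a
   basis and that [U *m A *m L^T] and [W *m A] are row free. *)
Inductive reduces n w (A : 'M[F]_n) (B : 'M[F]_w) (m1 m2 : nat) : Prop :=
  Reduces (U : 'M_(m2, n)) (W : 'M_(w, n)) (L : 'M_(m1, n))
    (U' : 'M_(n, m2)) (W' : 'M_(n, w)) (L' : 'M_(n, m1))
    (R : 'M_(m1, m2)) (R' : 'M_(n, w)) of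
    (m2 + (w + m1))%N = n
  & U' *m U + W' *m W + L' *m L = 1%:M
  & L *m A = 0 & W *m A *m L^T = 0
  & U *m A *m L^T *m R = 1%:M & W *m A *m R' = 1%:M
  & W *m A *m W^T = B.

(** A basis [L] of the left radical is completed by [W] to its left orthogonal [K], and by [U] to
    the whole space. Independence of [U] modulo [K] and of [W] modulo [L] yields the one-sided
    inverses. *)
Lemma reduces_exists n (A : 'M[F]_n) :
  exists w m2 (B : 'M[F]_w), reduces A B (n - \rank A) m2.
Proof.
rewrite -mxrank_ker.
have [L eqL] : exists L : 'M_(\rank (kermx A), n), (L :=: kermx A)%MS.
  by exists (row_base (kermx A)); apply: eq_row_base.
have LA : L *m A = 0 by apply/sub_kermxP; rewrite eqL.
pose K := kermx (A *m L^T).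
have LK : (L <= K)%MS by apply/sub_kermxP; rewrite mulmxA LA mul0mx.
have [W eqW Wfree] : exists2 W : 'M_(\rank (K :\: L)%MS, n), (W :=: K :\: L)%MS & row_free W.
  by exists (row_base (K :\: L)%MS); [apply: eq_row_base | apply: row_base_free].
have [U eqU Ufree] : exists2 U : 'M_(\rank (K^C)%MS, n), (U :=: K^C)%MS & row_free U.
  by exists (row_base (K^C)%MS); [apply: eq_row_base | apply: row_base_free].
have WK : (W <= K)%MS by rewrite eqW diffmxSl.
have full : row_full (col_mx U (col_mx W L)).
  rewrite -sub1mx -addsmxE; apply: (submx_trans (B := (K^C + K)%MS)).
    by rewrite sub1mx addsmxC addsmx_compl_full.
  apply: addsmxS; first by rewrite eqU.
  rewrite -(addsmx_diff_cap_eq K L) -addsmxE.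
  by apply: addsmxS; [rewrite eqW | apply: capmxSr].
exists (\rank (K :\: L)%MS), (\rank (K^C)%MS), (W *m A *m W^T).
have [Y] := row_fullP full.
rewrite -[Y]hsubmxK -[rsubmx Y]hsubmxK !mul_row_col addrA => eY.
have /row_freeP [R eR] : row_free (U *m A *m L^T).
  apply: inj_row_free => v; rewrite -!mulmxA mulmxA => v0.
  apply/eqP; rewrite -(mulmx_free_eq0 _ Ufree).
  rewrite -submx0 -(capmx_compl K) sub_capmx sub_kermx v0 eqxx /=.
  by rewrite (submx_trans (submxMl _ _)) // eqU.
have /row_freeP [R' eR'] : row_free (W *m A).
  apply: inj_row_free => v; rewrite mulmxA => v0.
  apply/eqP; rewrite -(mulmx_free_eq0 _ Wfree).
  rewrite -submx0 -(capmx_diff K L) sub_capmx (submx_trans (submxMl _ _)) ?eqW //=.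
  by rewrite eqL sub_kermx v0.
apply: (Reduces _ eY LA _ eR eR') => //; last first.
  by apply/eqP; rewrite -mulmxA -sub_kermx.
have := mxrank_cap_compl K L; rewrite (capmx_idPr LK) eqL mxrank_compl.
have := rank_leq_row K; lia.
Qed.

(** Pairing with [L] sees only the [U] coordinate of [x], and [R] recovers it; once it vanishes,
    [R'] recovers the [W] coordinate from [x *m A]. *)
Lemma radical_coordinates n w m1 m2 (A : 'M[F]_n) (U : 'M_(m2, n))
    (W : 'M_(w, n)) (L : 'M_(m1, n)) (U' : 'M_(n, m2)) (W' : 'M_(n, w))
    (L' : 'M_(n, m1)) (R : 'M_(m1, m2)) (R' : 'M_(n, w)) p (x : 'M_(p, n)) :
  U' *m U + W' *m W + L' *m L = 1%:M ->
  L *m A = 0 -> W *m A *m L^T = 0 ->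
  U *m A *m L^T *m R = 1%:M -> W *m A *m R' = 1%:M ->
  (x *m A *m L^T = 0 -> x = x *m W' *m W + x *m L' *m L) /\
  (x *m A = 0 -> x = x *m L' *m L).
Proof.
move=> e1 LA WL UL WR.
have xE : x = x *m U' *m U + x *m W' *m W + x *m L' *m L.
  by rewrite -!mulmxA -!mulmxDr e1 mulmx1.
move: (x *m U') (x *m W') (x *m L') xE => a b c ->.
have tL : c *m L *m A = 0 by rewrite -mulmxA LA mulmx0.
have tW : b *m W *m A *m L^T = 0 by rewrite -(mulmx0 _ b) -WL !mulmxA.
have a0 : (a *m U + b *m W + c *m L) *m A *m L^T = 0 -> a = 0.
  rewrite !mulmxDl tL tW mul0mx !addr0 => /(congr1 (mulmx^~ R)).
  have -> : a *m U *m A *m L^T *m R = a *m (U *m A *m L^T *m R) by rewrite !mulmxA.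
  by rewrite UL mulmx1 mul0mx.
split=> [/a0 -> | x0]; first by rewrite mul0mx add0r.
have a00 : a = 0 by apply: a0; rewrite x0 mul0mx.
move: x0; rewrite a00 mul0mx add0r mulmxDl tL addr0.
move/(congr1 (mulmx^~ R')).
have -> : b *m W *m A *m R' = b *m (W *m A *m R') by rewrite !mulmxA.
by rewrite WR mulmx1 mul0mx => ->; rewrite mul0mx add0r.
Qed.

(** The rows of [L] span [kermx A], and the size equation forces them to be independent; hence [m1]
    is an invariant of [A]. *)
Lemma reduces_kernel n w (A : 'M[F]_n) (B : 'M[F]_w) m1 m2 :
  reduces A B m1 m2 -> (n - \rank A)%N = m1.
Proof.
case=> U W L U' W' L' R R' en e1 LA WL UL WR _.
have eL : (L :=: kermx A)%MS.
  apply/eqmxP/andP; split; first exact/sub_kermxP.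
  have [_ ->] := radical_coordinates (kermx A) e1 LA WL UL WR.
    exact: submxMl.
  exact: mulmx_ker.
have full : row_full (col_mx U (col_mx W L)).
  by apply/row_fullP; exists (row_mx U' (row_mx W' L')); rewrite !mul_row_col addrA.
rewrite -mxrank_ker -eL; apply/eqP; rewrite eqn_leq rank_leq_row /=.
move: full; rewrite -col_leq_rank -addsmxE.
have := (mxrank_adds_leqif U (col_mx W L)).1; rewrite -addsmxE.
have := (mxrank_adds_leqif W L).1.
have := rank_leq_row U; have := rank_leq_row W; lia.
Qed.

Lemma dsum2_reduces n w (A : 'M[F]_n) (B : 'M[F]_w) m1 m2
    n' w' (A' : 'M[F]_n') (B' : 'M[F]_w') m1' m2' :
  reduces A B m1 m2 -> reduces A' B' m1' m2' ->
  reduces (dsum2 A A') (dsum2 B B') (m1 + m1') (m2 + m2').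
Proof.
case=> U W L U' W' L' R R' en e1 LA WL UL WR WW.
case=> V X K V' X' K' T T' en' e1' KA XK VK XT XX.
have diagM a b c d e f (P : 'M[F]_(a, b)) (Q : 'M[F]_(c, d)) (P' : 'M[F]_(b, e))
    (Q' : 'M[F]_(d, f)) : block_mx P 0 0 Q *m block_mx P' 0 0 Q' =
    block_mx (P *m P') 0 0 (Q *m Q').
  by rewrite mulmx_block !(mulmx0, mul0mx, addr0, add0r).
have diag0 a b c d : block_mx (0 : 'M[F]_(a, b)) 0 0 (0 : 'M[F]_(c, d)) = 0.
  exact: block_mx_const.
apply: (Reduces (U := block_mx U 0 0 V) (W := block_mx W 0 0 X)
  (L := block_mx L 0 0 K) (U' := block_mx U' 0 0 V') (W' := block_mx W' 0 0 X')
  (L' := block_mx L' 0 0 K') (R := block_mx R 0 0 T) (R' := block_mx R' 0 0 T')).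
- lia.
- by rewrite !diagM !add_block_mx !addr0 e1 e1' -scalar_mx_block.
- by rewrite diagM LA KA diag0.
- by rewrite tr_block_mx !trmx0 !diagM WL XK diag0.
- by rewrite tr_block_mx !trmx0 !diagM UL VK -scalar_mx_block.
- by rewrite !diagM WR XT -scalar_mx_block.
- by rewrite tr_block_mx !trmx0 !diagM WW XX.
Qed.

Lemma reduces_unit n (A : 'M[F]_n) : A \in unitmx -> reduces A A 0 0.
Proof.
move=> Au; apply: (Reduces (U := 0) (W := 1%:M) (L := 0) (U' := 0) (W' := 1%:M)
  (L' := 0) (R := 0) (R' := invmx A)).
- by rewrite add0n addn0.
- by rewrite !mulmx0 mulmx1 add0r addr0.
- by rewrite mul0mx.
- by rewrite trmx0 mulmx0.
- by rewrite flatmx0 [RHS]flatmx0.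
- by rewrite mul1mx mulmxV.
- by rewrite trmx1 mul1mx mulmx1.
Qed.

Lemma reduces_hcongl n n' w (A : 'M[F]_n) (A' : 'M[F]_n') (B : 'M[F]_w) m1 m2 :
  hcong A' A -> reduces A B m1 m2 -> reduces A' B m1 m2.
Proof.
case=> e; subst n'; case=> X Xf <-; case=> U W L U' W' L' R R' en e1 LA WL UL WR WW.
rewrite row_free_unit in Xf.
have iX : invmx X *m X = 1%:M by rewrite mulVmx.
have XT : X^T \in unitmx by rewrite unitmx_tr.
apply: (Reduces (U := U *m X) (W := W *m X) (L := L *m X) (U' := invmx X *m U')
  (W' := invmx X *m W') (L' := invmx X *m L') (R := R) (R' := X^T *m R')) => //.
- rewrite -!mulmxA -!mulmxDr !mulmxA -!mulmxDl e1 mul1mx iX.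
  by [].
- apply: (can_inj (mulmxK XT)); rewrite mul0mx -LA !mulmxA //.
- by rewrite trmx_mul -WL !mulmxA.
- by rewrite trmx_mul -UL !mulmxA.
- by rewrite -WR !mulmxA.
- by rewrite trmx_mul -WW !mulmxA.
Qed.

Lemma reduces_hcongr n w w' (A : 'M[F]_n) (B : 'M[F]_w) (B' : 'M[F]_w') m1 m2 :
  hcong B B' -> reduces A B m1 m2 -> reduces A B' m1 m2.
Proof.
case=> e; subst w'; case=> X Xf <-; case=> U W L U' W' L' R R' en e1 LA WL UL WR WW.
rewrite row_free_unit in Xf.
apply: (Reduces (U := U) (W := X *m W) (L := L) (U' := U')
  (W' := W' *m invmx X) (L' := L') (R := R) (R' := R' *m invmx X)) => //.
- by rewrite mulmxA (mulmxKV Xf).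
- by rewrite -!mulmxA (mulmxA W) WL mulmx0.
- by rewrite -!mulmxA !(mulmxA W) (mulmxA _ R') WR mul1mx mulmxV.
- by rewrite trmx_mul -WW !mulmxA.
Qed.

(** Modulo the radical, [X *m W'] and [W *m X'] are mutually inverse transition matrices between the
    two bases of the quotient. *)
Lemma reduces_inj n w w' (A : 'M[F]_n) (B : 'M[F]_w) (B' : 'M[F]_w') m1 m2 m1' m2' :
  reduces A B m1 m2 -> reduces A B' m1' m2' -> [/\ m1 = m1', m2 = m2' & hcong B B'].
Proof.
move=> r r'; have em1 : m1 = m1'.
  by rewrite -(reduces_kernel r) (reduces_kernel r').
subst m1'.
case: r => U W L U' W' L' R R' en e1 LA WL UL WR WW.
case: r' => V X K V' X' K' T T' en' e1' KA XK VK XT XX.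
have [cX _] := radical_coordinates X e1 LA WL UL WR.
have [_ cK] := radical_coordinates K e1 LA WL UL WR.
have [cW _] := radical_coordinates W e1' KA XK VK XT.
have [_ cL] := radical_coordinates L e1' KA XK VK XT.
have XE : X = X *m W' *m W + X *m L' *m L.
  by apply: cX; rewrite (cL LA) trmx_mul mulmxA XK mul0mx.
have WE : W = W *m X' *m X + W *m K' *m K.
  by apply: cW; rewrite (cK KA) trmx_mul mulmxA WL mul0mx.
have XA : X *m A = X *m W' *m (W *m A) by rewrite {1}XE mulmxDl -!mulmxA LA !mulmx0 addr0.
have WA : W *m A = W *m X' *m (X *m A) by rewrite {1}WE mulmxDl -!mulmxA KA !mulmx0 addr0.
have id1 : W *m X' *m (X *m W') = 1%:M.
  by have := WR; rewrite WA XA -!mulmxA (mulmxA W A) WR mulmx1 !mulmxA.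
have id2 : X *m W' *m (W *m X') = 1%:M.
  by have := XT; rewrite XA WA -!mulmxA (mulmxA X A) XT mulmx1 !mulmxA.
have f1 : row_free (W *m X') by apply/row_freeP; exists (X *m W').
have f2 : row_free (X *m W') by apply/row_freeP; exists (W *m X').
have ew : w = w'.
  have := rank_leq_col (W *m X'); rewrite (eqP f1).
  have := rank_leq_col (X *m W'); rewrite (eqP f2); lia.
split=> //; first by lia.
split=> //; exists (X *m W') => //.
have s1 : W *m A *m X^T = B *m (X *m W')^T.
  rewrite {1}XE linearD /= (trmx_mul (X *m W')) (trmx_mul (X *m L')) mulmxDr.
  by rewrite !mulmxA WL mul0mx addr0 WW.
by rewrite -[LHS]mulmxA -s1 -XX XA !mulmxA.
Qed.

Lemma row_free_pid m n (P : 'M[F]_(m, n)) :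
  row_free P -> exists2 h : 'M_n, h \in unitmx & P *m h = pid_mx m.
Proof.
move=> Pf; have mn : (m <= n)%N by rewrite -(eqP Pf) rank_leq_col.
have pidK : pid_mx m *m (pid_mx m : 'M_(n, m)) = 1%:M :> 'M[F]_m.
  by rewrite mul_pid_mx minnn (minn_idPr mn) pid_mx_1.
have e : pid_mx m *m ((pid_mx m : 'M_(n, m)) *m P) = P by rewrite mulmxA pidK mul1mx.
have [|g gu] := @complete_unitmx F m n (pid_mx m) (pid_mx m *m P); rewrite e.
  by rewrite (eqP Pf) rank_pid_mx.
by move=> eP; exists (invmx g); rewrite ?unitmx_inv // eP mulmxK.
Qed.

(** Solvability criterion for [B *m Y = Z], with the pseudo-inverse supplying a solution. *)
Lemma kermx_mul_eq0 m n p (B : 'M[F]_(m, n)) (Z : 'M_(m, p)) :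
  kermx B *m Z = 0 -> B *m (pinvmx B *m Z) = Z.
Proof.
rewrite /kermx -mulmxA mulmxBl mul1mx => /eqP; rewrite subr_eq0 => /eqP eZ.
rewrite -{1}[B]mulmx_ebase /pinvmx -!mulmxA mulKVmx ?row_ebase_unit //.
rewrite (mulmxA (pid_mx _) (pid_mx _)) pid_mx_id ?rank_leq_col //.
by rewrite -eZ mulKVmx ?col_ebase_unit.
Qed.

(* A form with radical quotient [B] is congruent to the block matrix with rows
   [0 0 (I 0)], [D B 0], [0 0 0], where the columns of [D] are fixed lifts of
   a basis of the cokernel of [B], padded by zeros. *)
Lemma reduces_normal_form w (B : 'M[F]_w) m1 m2 :
  exists C : 'M[F]_(m2 + (w + m1)),
  forall n (A : 'M[F]_n), reduces A B m1 m2 -> hcong A C.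
Proof.
have [K eK /row_freeP[K' KK']] :
    exists2 K : 'M_(\rank (kermx B), w), (K :=: kermx B)%MS & row_free K.
  by exists (row_base (kermx B)); [apply: eq_row_base | apply: row_base_free].
have KB : K *m B = 0 by apply/sub_kermxP; rewrite eK.
pose D0 : 'M_(w, m2) := K' *m pid_mx (\rank (kermx B)).
exists (block_mx 0 (row_mx 0 (pid_mx m2))
  (col_mx D0 0) (block_mx B 0 0 0)).
move=> n A [] U W L U' W' L' R R' en e1 LA WL UL WR WW.
have [D eD] : exists D, W *m A *m U^T = D by exists (W *m A *m U^T).
(* [W *m A] has full row rank and kills [L], so the columns of [D] and of [B] together span: [D]
   covers the cokernel of [B]. *)
have Dfull : D *m (U'^T *m R') + B *m (W'^T *m R') = 1%:M.
  have := congr1 trmx e1; rewrite trmx1 !linearD /= !trmx_mul => e1T.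
  rewrite !mulmxA -mulmxDl -WR; congr (_ *m _).
  rewrite -[RHS]mulmx1 -e1T !mulmxDr !mulmxA WL.
  by rewrite mul0mx addr0 WW eD.
(* Changing the rows [U] by [g] gives [D] and [D0] the same image under [K], that is, in the
   cokernel of [B]; adding rows of [W] through [X] then absorbs the remaining difference. *)
have [g gu KDg] : exists2 g, g \in unitmx & K *m D *m g = pid_mx (\rank (kermx B)).
  apply: row_free_pid; apply/row_freeP.
  have := congr1 (fun z => K *m z *m K') Dfull.
  rewrite mulmx1 mulmxDr !mulmxA KB !mul0mx addr0 KK' -!mulmxA => e.
  by eexists; rewrite -mulmxA; exact: e.
have [X eX] : exists X, D *m g + B *m X = D0.
  exists (pinvmx B *m (D0 - D *m g)); rewrite kermx_mul_eq0; first exact: subrKC.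
  have /submxP[x ->] : (kermx B <= K)%MS by rewrite eK.
  by rewrite -mulmxA mulmxBr !mulmxA KDg KK' mul1mx subrr mulmx0.
pose U2 := g^T *m U + X^T *m W.
have WU2 : W *m A *m U2^T = D0.
  by rewrite linearD /= !trmx_mul !trmxK mulmxDr !mulmxA WW eD.
have eU : U = invmx g^T *m (U2 - X^T *m W).
  by rewrite addrK mulKmx // unitmx_tr.
have U2L : U2 *m A *m L^T *m (R *m invmx g^T) = 1%:M.
  rewrite !mulmxDl -(mulmxA X^T W) -(mulmxA X^T (W *m A)) WL mulmx0 mul0mx addr0.
  have -> : g^T *m U *m A *m L^T *m (R *m invmx g^T) =
            g^T *m (U *m A *m L^T *m R) *m invmx g^T by rewrite !mulmxA.
  by rewrite UL mulmx1 mulmxV // unitmx_tr.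
clearbody U2.
have [h hu Ph] : exists2 h, h \in unitmx & U2 *m A *m L^T *m h = pid_mx m2.
  apply: row_free_pid; apply/row_freeP.
  by exists (R *m invmx g^T).
pose L1 := h^T *m L.
have L1A : L1 *m A = 0 by rewrite -mulmxA LA mulmx0.
have U2L1 : U2 *m A *m L1^T = pid_mx m2 by rewrite trmx_mul trmxK mulmxA.
have WL1 : W *m A *m L1^T = 0 by rewrite trmx_mul trmxK mulmxA WL mul0mx.
have eL : L = invmx h^T *m L1 by rewrite mulKmx // unitmx_tr.
clearbody L1.
have m21 : (m2 <= m1)%N.
  have/eqP <- : row_free (U2 *m A *m L^T) by apply/row_freeP; exists (R *m invmx g^T).
  exact: rank_leq_col.
pose pd : 'M[F]_(m2, m1) := pid_mx m2.
have pdK : pd *m pd^T = 1%:M.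
  by rewrite tr_pid_mx mul_pid_mx minnn (minn_idPr m21) pid_mx_1.
have L1A_ p q (y : 'M_(p, m1)) (z : 'M_(n, q)) : y *m L1 *m A *m z = 0.
  by rewrite -(mulmxA y) L1A mulmx0 mul0mx.
(* Rows of [L1] pair only with [U2], and only from the right. Subtracting multiples of them from
   [W], then from [U2], clears the pairings of [U2] with [W] and with itself and leaves the other
   blocks intact. *)
pose W1 := W - (U2 *m A *m W^T)^T *m pd *m L1.
have U2W1 : U2 *m A *m W1^T = 0.
  rewrite linearB /= 2!trmx_mul trmxK mulmxBr [X in _ - X]mulmxA U2L1.
  by rewrite [X in _ - X]mulmxA pdK mul1mx subrr.
have W1L1 : W1 *m A *m L1^T = 0 by rewrite !mulmxBl WL1 L1A_ subr0.
have W1U2 : W1 *m A *m U2^T = D0 by rewrite !mulmxBl WU2 L1A_ subr0.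
have W1W1 : W1 *m A *m W1^T = B.
  rewrite !mulmxBl L1A_ subr0 linearB /= trmx_mul mulmxBr WW.
  by rewrite [X in _ - X]mulmxA WL1 mul0mx subr0.
have eW : W = W1 + (U2 *m A *m W^T)^T *m pd *m L1 by rewrite subrK.
clearbody W1.
pose U3 := U2 - (U2 *m A *m U2^T)^T *m pd *m L1.
have U3L1 : U3 *m A *m L1^T = pd by rewrite !mulmxBl U2L1 L1A_ subr0.
have U3W1 : U3 *m A *m W1^T = 0 by rewrite !mulmxBl U2W1 L1A_ subr0.
have W1U3 : W1 *m A *m U3^T = D0.
  by rewrite linearB /= trmx_mul mulmxBr W1U2 [X in _ - X]mulmxA W1L1 mul0mx subr0.
have U3U3 : U3 *m A *m U3^T = 0.
  rewrite !mulmxBl L1A_ subr0 linearB /= 2!trmx_mul trmxK mulmxBr.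
  by rewrite [X in _ - X]mulmxA U2L1 [X in _ - X]mulmxA pdK mul1mx subrr.
have eU3 : U2 = U3 + (U2 *m A *m U2^T)^T *m pd *m L1 by rewrite subrK.
clearbody U3.
pose Z := col_mx U3 (col_mx W1 L1).
have L1Z p (y : 'M_(p, _)) : (y *m L1 <= Z)%MS.
  apply: mulmx_sub; rewrite -addsmxE; apply: submx_trans (addsmxSr _ _).
  by rewrite -addsmxE addsmxSr.
have WZ p (y : 'M_(p, _)) : (y *m W <= Z)%MS.
  rewrite mulmx_sub // eW addmx_sub ?L1Z // -addsmxE.
  by apply: submx_trans (addsmxSr _ _); rewrite -addsmxE addsmxSl.
have UZ p (y : 'M_(p, _)) : (y *m U <= Z)%MS.
  rewrite mulmx_sub // eU mulmx_sub // addmx_sub //; last by rewrite eqmx_opp.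
  by rewrite eU3 addmx_sub // -addsmxE addsmxSl.
have Zf : row_full Z.
  by rewrite -sub1mx -e1 !addmx_sub // eL mulmxA.
split=> //; exists Z.
  by rewrite /row_free (eqP Zf) en.
rewrite /Z !tr_col_mx !mul_col_mx !mul_mx_row U3U3 U3W1 U3L1 W1U3 W1W1 W1L1 L1A.
rewrite !mul0mx /block_mx; congr col_mx.
by rewrite -[RHS]block_mxEh.
Qed.

Lemma reduces_cong n n' w (A : 'M[F]_n) (A' : 'M[F]_n') (B : 'M[F]_w) m1 m2 :
  reduces A B m1 m2 -> reduces A' B m1 m2 -> hcong A A'.
Proof.
have [C hC] := reduces_normal_form B m1 m2.
by move=> /hC AC /hC A'C; apply: hcong_trans (hcong_sym A'C).
Qed.

(** The rank [w] of [W *m A] comes from [B] and from the pairing with the [m2] rows of [U]. These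
    bounds make the block counts in [regularization_exists] nonnegative. *)
Lemma reduces_leq n w (A : 'M[F]_n) (B : 'M[F]_w) m1 m2 :
  reduces A B m1 m2 -> (w - \rank B <= m2 <= m1)%N.
Proof.
case=> U W L U' W' L' R R' en e1 LA WL UL WR WW.
have/eqP rU : row_free (U *m A *m L^T) by apply/row_freeP; exists R.
have := rank_leq_col (U *m A *m L^T); rewrite rU => ->; rewrite andbT leq_subLR.
have := congr1 trmx e1; rewrite trmx1 !linearD /= !trmx_mul => e1T.
have : W *m A *m U^T *m (U'^T *m R') + B *m (W'^T *m R') = 1%:M.
  rewrite !mulmxA -mulmxDl -WR; congr (_ *m _).
  rewrite -[RHS]mulmx1 -e1T !mulmxDr !mulmxA WL.
  by rewrite mul0mx addr0 WW.
move/(congr1 (@mxrank F w w)); rewrite mxrank1 => rk.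
rewrite -{1}rk addnC; apply: leq_trans (mxrank_add _ _) _; apply: leq_add.
  exact: leq_trans (mxrankM_maxl _ _) (rank_leq_col _).
exact: mxrankM_maxl.
Qed.

Lemma mul_rowsub1 m n p (A : 'M[F]_n) (f : 'I_m -> 'I_n) (g : 'I_p -> 'I_n) :
  rowsub f 1%:M *m A *m (rowsub g 1%:M)^T = mxsub f g A.
Proof.
by rewrite mul_rowsub_mx mul1mx trmx_mxsub trmx1 mulmx_colsub mulmx1 -mxsub_comp.
Qed.

(** For [n >= 2] the last basis vector spans the left radical, the one before it is [U], and the
    others carry [jordan n.-2 0]. The booleans serve as dimensions, which covers [n = 0] and [n = 1]
    as well. *)
Lemma jordan0_reduces n : reduces (jordan n 0 : 'M[F]_n) (jordan n.-2 0) (0 < n) (1 < n).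
Proof.
case: n => [|[|k]] /=.
- apply: (Reduces (U := 0) (W := 0) (L := 0) (U' := 0) (W' := 0) (L' := 0)
    (R := 0) (R' := 0)); rewrite ?addn0 //; by apply/matrixP; case.
- change (reduces (jordan 1 0 : 'M[F]_1) (jordan 0 0) 1 0).
  apply: (Reduces (U := 0) (W := 0) (L := 1%:M) (U' := 0) (W' := 0) (L' := 1%:M)
    (R := 0) (R' := 0)); rewrite ?mul0mx ?mul1mx ?add0r //.
  + by apply/matrixP=> i j; rewrite !mxE !ord1 eqxx.
  + by apply/matrixP; case.
  + by apply/matrixP; case.
  + by apply/matrixP; case.
pose u (i : 'I_1) : 'I_k.+2 := inord k.
pose l (i : 'I_1) : 'I_k.+2 := ord_max.
pose f (i : 'I_k) : 'I_k.+2 := widen_ord (leqW (leqnSn k)) i.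
pose h (i : 'I_k) : 'I_k.+2 := lift ord0 (widen_ord (leqnSn k) i).
have uE i : u i = k :> nat by rewrite inordK.
apply: (Reduces (U := rowsub u 1%:M) (W := rowsub f 1%:M) (L := rowsub l 1%:M)
  (U' := (rowsub u 1%:M)^T) (W' := (rowsub f 1%:M)^T) (L' := (rowsub l 1%:M)^T)
  (R := 1%:M) (R' := (rowsub h 1%:M)^T)).
- lia.
- apply/matrixP=> i j; rewrite !mxE !big_ord1 !mxE.
  under eq_bigr do rewrite !mxE.
  have -> : (i == j)%:R = \sum_(a < k.+2) (a == i)%:R * (a == j)%:R :> F.
    by rewrite (bigD1 i) //= eqxx mul1r big1 ?addr0 // => a /negbTE->; rewrite mul0r.
  rewrite !big_ord_recr /= -!val_eqE /= uE; congr (_ + _).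
  by rewrite addrC; congr (_ + _); apply: eq_bigr => a _; rewrite -!val_eqE.
- rewrite mul_rowsub_mx mul1mx; apply/matrixP=> i j; rewrite !mxE /=.
  by do 2!case: ifP => //; have := ltn_ord j; lia.
- rewrite mul_rowsub1; apply/matrixP=> i j; rewrite !mxE /=.
  by do 2!case: ifP => //; have := ltn_ord i; lia.
- rewrite mul_rowsub1 mulmx1; apply/matrixP=> i j; rewrite !mxE uE /=.
  by rewrite !ord1 eqxx; case: ifP => // /eqP; lia.
- rewrite mul_rowsub1; apply/matrixP=> i j; rewrite !mxE /=.
  rewrite /bump /= add1n eqSS -val_eqE /= [j == i :> nat]eq_sym.
  by case: (eqVneq (i : nat) j) => [->|_]; [rewrite ltn_eqF | case: ifP].
- by rewrite mul_rowsub1; apply/matrixP=> i j; rewrite !mxE.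
Qed.

End Regularization.

(** * The singular part as a sum of nilpotent Jordan blocks *)

Section JordanZero.
Variables (F : fieldType) (S : forall n, 'M[F]_n).

Definition jsum (s : seq nat) := dsum S [seq BJ0 F n | n <- s].

Lemma jsum_reduces s :
  reduces (jsum s) (jsum [seq n.-2 | n <- s])
    (count (leq 1) s) (count (leq 2) s).
Proof.
elim: s => [|n s IH]; last exact: dsum2_reduces (jordan0_reduces F n) IH.
by apply: reduces_unit; rewrite unitmxE det_mx00 unitr1.
Qed.

Lemma jsum_dsum2_reduces s c (C : 'M[F]_c) : C \in unitmx ->
  reduces (dsum2 (jsum s) C) (dsum2 (jsum [seq n.-2 | n <- s]) C)
    (count (leq 1) s) (count (leq 2) s).
Proof.
move=> Cu; rewrite -[count (leq 1) s]addn0 -[count (leq 2) s]addn0.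
exact: dsum2_reduces (jsum_reduces s) (reduces_unit Cu).
Qed.

(** Lowering block sizes by 2 leaves empty blocks behind, which have to be discarded. *)
Lemma jsum_zero t m (A : 'M[F]_m) :
  count (leq 1) t = 0%N -> hcong (dsum2 (jsum t) A) A.
Proof.
elim: t => [_|[|n] t IH] /=; [exact: hcong_dsum2_0l | | by []].
move/IH; apply: hcong_trans; apply: hcong_dsum2 (hcong_refl _).
exact: hcong_dsum2_0l.
Qed.

Lemma jsum_cat_zero s t :
  count (leq 1) t = 0%N -> hcong (jsum (s ++ t)) (jsum s).
Proof.
move=> t0; rewrite /jsum map_cat; apply: hcong_trans (dsum_cat _ _ _) _.
apply: hcong_trans (hcong_dsum2C _ _) _; exact: jsum_zero.
Qed.

Lemma regularization_exists n (A : 'M[F]_n) :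
  exists s c (C : 'M[F]_c),
    [/\ all (leq 1) s, C \in unitmx & hcong A (dsum2 (jsum s) C)].
Proof.
elim/ltn_ind: n A => n IH A.
have [Au | An] := boolP (A \in unitmx).
  by exists [::], n, A; split=> //; apply/hcong_sym/hcong_dsum2_0l.
have [w [m2 [B r]]] := reduces_exists A; set m1 := (n - \rank A)%N in r.
have /andP[m2B m21] := reduces_leq r.
have m1_gt0 : (0 < m1)%N.
  rewrite subn_gt0 ltn_neqAle rank_leq_row andbT.
  by rewrite -row_free_unit in An.
have wn : (w < n)%N by case: r => *; lia.
have [s [c [C [s1 Cu BC]]]] := IH w wn B.
have rB : (w - \rank B)%N = size s.
  have := reduces_kernel (reduces_hcongl BC (jsum_dsum2_reduces s Cu)) => ->.
  by apply/eqP; rewrite -all_count.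
rewrite rB in m2B.
(* [z] restores the blocks of sizes 2 and 1 that reduction erases, in the numbers that give [s']
   exactly [m2] blocks of size at least 2 and [m1] of size at least 1. Both forms then reduce to the
   same data. *)
pose z := nseq (m2 - size s) 2%N ++ nseq (m1 - m2) 1%N.
pose s' := [seq n.+2 | n <- s] ++ z.
exists s', c, C; split=> //.
  rewrite !all_cat !all_nseq !orbT !andbT; apply/allP=> _ /mapP[x _ ->] //.
have cnt (b : nat) : (b <= 2)%N -> count (leq b) [seq n.+2 | n <- s] = size s.
  move=> b2; apply/eqP; rewrite -[X in _ == X](size_map (fun n => n.+2)) -all_count.
  by apply/allP=> _ /mapP[x _ ->]; apply: leq_trans b2 _.
have c1 : count (leq 1) s' = m1.
  rewrite !count_cat cnt // !count_nseq /=; lia.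
have c2 : count (leq 2) s' = m2.
  rewrite !count_cat cnt // !count_nseq /=; lia.
have := jsum_dsum2_reduces s' Cu; rewrite c1 c2; apply: reduces_cong.
apply: reduces_hcongr r; apply: hcong_trans BC _; apply: hcong_sym.
apply: hcong_dsum2 (hcong_refl _); rewrite map_cat -map_comp map_id_in //.
by apply: jsum_cat_zero; rewrite map_cat !map_nseq count_cat !count_nseq.
Qed.

Lemma regularization_uniq s1 s2 c1 c2 (C1 : 'M[F]_c1) (C2 : 'M[F]_c2) :
  C1 \in unitmx -> C2 \in unitmx ->
  hcong (dsum2 (jsum s1) C1) (dsum2 (jsum s2) C2) ->
  (forall k, (0 < k)%N -> count_mem k s1 = count_mem k s2) /\ hcong C1 C2.
Proof.
(* Each reduction compares the numbers of blocks of size at least 1 and at least 2, and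
   multiplicities are differences of such counts. The number of nonempty blocks joins the claim
   because, for the reduced lists, it counts the blocks of size at least 3. *)
move=> C1u C2u h; suff [h1 h2 h3] :
    [/\ forall k, (0 < k)%N -> count_mem k s1 = count_mem k s2, hcong C1 C2 &
     count (leq 1) s1 = count (leq 1) s2] by [].
have [N] := ubnP (sumn s1); elim: N s1 s2 h => // N IH s1 s2 h sN.
have [e1 e2 h'] := reduces_inj (jsum_dsum2_reduces s1 C1u)
  (reduces_hcongl h (jsum_dsum2_reduces s2 C2u)).
have cz s k : count (leq 1) s = 0%N -> (0 < k)%N -> count_mem k s = 0%N.
  elim: s => [//|[|a] s IHs] //= s0 k0; rewrite IHs //.
  by case: k k0 {IHs}.
have [z1|nz1] := posnP (count (leq 1) s1).
  split=> //; first by move=> k k0; rewrite !cz // -e1.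
  apply: hcong_trans (hcong_sym (jsum_zero C1 z1)) _.
  by apply: hcong_trans h _; apply: jsum_zero; rewrite -e1.
have [|hk hC h3] := IH _ _ h'.
  rewrite ltnS in sN; apply: leq_trans sN => {IH h h' e1 e2}.
  elim: s1 nz1 => //= a s IHs; have [a0|] := posnP a.
    by rewrite a0 /= !add0n.
  move=> a0 _; case: (posnP (count (leq 1) s)) => [z|/IHs]; last by lia.
  have -> : sumn [seq n.-2 | n <- s] = 0%N.
    elim: s z {IHs} => //= b s IHs; case: b => //=.
  lia.
have ct3 s : count (leq 2) s = (count_mem 2 s + count (leq 1) [seq n.-2 | n <- s])%N.
  by elim: s => //= a s ->; case: a => [|[|[|a]]] //=; lia.
have ct2 s : count (leq 1) s = (count_mem 1 s + count (leq 2) s)%N.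
  by elim: s => //= a s ->; case: a => [|[|a]] //=; lia.
have ct4 s k : count_mem k.+1 [seq n.-2 | n <- s] = count_mem k.+3 s.
  by rewrite count_map; apply: eq_count => -[|[|a]].
split=> // -[//|[|[|k]]] _.
- by move: e1; rewrite !ct2; lia.
- by move: e2; rewrite !ct3; lia.
- by rewrite -!ct4; apply: hk.
Qed.

End JordanZero.

(** * Splitting nonsingular forms *)

Section MatrixPowers.
Variables (F : fieldType) (n : nat).
Implicit Types L N T : 'M[F]_n.

Lemma expmx0 N : N ^+ 0 = 1%:M. Proof. exact: expr0. Qed.
Lemma expmx1 N : N ^+ 1 = N. Proof. exact: expr1. Qed.
Lemma expmxS N i : N ^+ i.+1 = N *m N ^+ i. Proof. exact: exprS. Qed.
Lemma expmxSr N i : N ^+ i.+1 = N ^+ i *m N. Proof. exact: exprSr. Qed.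
Lemma expmxD N i j : N ^+ (i + j) = N ^+ i *m N ^+ j. Proof. exact: exprD. Qed.

Lemma expmx_leq0 N i j : (i <= j)%N -> N ^+ i = 0 -> N ^+ j = 0.
Proof. by move=> ij N0; rewrite -(subnKC ij) expmxD N0 mul0mx. Qed.

Lemma mul_expmx_leq0 p (x : 'M_(p, n)) N i j :
  (i <= j)%N -> x *m N ^+ i = 0 -> x *m N ^+ j = 0.
Proof. by move=> ij N0; rewrite -(subnKC ij) expmxD mulmxA N0 mul0mx. Qed.

Lemma expmx_unit L i : L \in unitmx -> L ^+ i \in unitmx.
Proof.
move=> Lu; elim: i => [|i IH]; first by rewrite expmx0 unitmx1.
by rewrite expmxS unitmx_mul Lu.
Qed.

End MatrixPowers.

(** * Bilinear forms on row vectors *)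

Section BilinearForm.
Variables (F : fieldType) (n : nat).
Implicit Types (A K : 'M[F]_n) (x y z : 'rV[F]_n).

Definition bform A x y : F := (x *m A *m y^T) 0 0.

Lemma bformDl A x y z : bform A (x + y) z = bform A x z + bform A y z.
Proof. by rewrite /bform !mulmxDl mxE. Qed.

Lemma bformDr A x y z : bform A z (x + y) = bform A z x + bform A z y.
Proof. by rewrite /bform linearD mulmxDr mxE. Qed.

Lemma bformZl A a x z : bform A (a *: x) z = a * bform A x z.
Proof. by rewrite /bform -!scalemxAl mxE. Qed.

Lemma bformZr A a x z : bform A z (a *: x) = a * bform A z x.
Proof. by rewrite /bform linearZ -scalemxAr mxE. Qed.

Lemma bform0l A x : bform A 0 x = 0.
Proof. by rewrite /bform !mul0mx mxE. Qed.

Lemma bform0r A x : bform A x 0 = 0.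
Proof. by rewrite /bform trmx0 mulmx0 mxE. Qed.

Lemma gramE A p q (X : 'M_(p, n)) (Y : 'M_(q, n)) i j :
  (X *m A *m Y^T) i j = bform A (row i X) (row j Y).
Proof.
rewrite /bform -!row_mul [LHS]mxE 2![RHS]mxE; apply: eq_bigr => k _.
by congr (_ * _); rewrite !mxE.
Qed.

End BilinearForm.

(** * The cosquare as an operator on rows, and orthogonal splitting *)

Section Asymmetry.
Variables (F : fieldType) (n : nat) (A : 'M[F]_n).
Hypothesis Au : A \in unitmx.

(* The cosquare acting on rows, and its inverse. *)
Definition asym : 'M[F]_n := A^T *m invmx A.
Definition asymV : 'M[F]_n := A *m invmx A^T.

Lemma trmx_asym : asym^T = cosquare A.
Proof. by rewrite /asym trmx_mul trmx_inv trmxK. Qed.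

Lemma asymK : asym *m asymV = 1%:M.
Proof. by rewrite mulmxA mulmxKV // mulmxV // unitmx_tr. Qed.

Lemma asymVK : asymV *m asym = 1%:M.
Proof. exact/mulmx1C/asymK. Qed.

Lemma asym_mul : asym *m A = A^T.
Proof. by rewrite mulmxKV. Qed.

Lemma mul_asymV_tr : A *m asymV^T = A^T.
Proof. by rewrite trmx_mul trmx_inv trmxK mulmxA mulmxV // mul1mx. Qed.

Lemma bform_asym x y : bform A (y *m asym) x = bform A x y.
Proof.
rewrite /bform -(mulmxA y) asym_mul.
have -> : y *m A^T *m x^T = (x *m A *m y^T)^T by rewrite !trmx_mul trmxK mulmxA.
by rewrite mxE.
Qed.

Definition shift lam : 'M[F]_n := asym - lam%:M.
Definition shiftV lam : 'M[F]_n := asymV - lam%:M.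

Lemma shift_adjoint lam : shift lam *m A = A *m (shiftV lam)^T.
Proof.
rewrite mulmxBl asym_mul linearB /= tr_scalar_mx mulmxBr mul_asymV_tr.
by rewrite scalar_mxC.
Qed.

Lemma exp_shift_adjoint lam i :
  shift lam ^+ i *m A = A *m (shiftV lam ^+ i)^T.
Proof.
elim: i => [|i IH]; first by rewrite !expmx0 trmx1 mulmx1 mul1mx.
by rewrite expmxS -mulmxA IH mulmxA shift_adjoint -mulmxA -trmx_mul -expmxSr.
Qed.

Lemma bform_shift lam i x y :
  bform A (x *m shift lam ^+ i) y = bform A x (y *m shiftV lam ^+ i).
Proof. by rewrite /bform -(mulmxA x _ A) exp_shift_adjoint trmx_mul !mulmxA. Qed.

(** An injective map of a finite-dimensional space into itself is onto, so stability passes to the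
    inverse. *)
Lemma stable_asym p (U : 'M_(p, n)) : (U *m asymV <= U)%MS -> (U *m asym <= U)%MS.
Proof.
move=> UU; have Vf : row_free asymV by apply/row_freeP; exists asym; apply: asymVK.
have e : (U *m asymV == U)%MS by rewrite -(mxrank_leqif_eq UU) mxrankMfree.
rewrite -{2}(mulmx1 U) -asymVK mulmxA; apply: submxMr.
by rewrite (eqmxP e).
Qed.

(** [V] spans the right orthogonal of [Z]. Stability of [Z] under [asym A] makes it the left
    orthogonal too, and the nonsingular Gram matrix makes the sum direct. *)
Lemma split_off c (Z : 'M_(c, n)) :
  Z *m A *m Z^T \in unitmx -> (Z *m asym <= Z)%MS ->
  exists m (A' : 'M[F]_m), [/\ (c + m)%N = n, A' \in unitmx &
    hcong A (dsum2 (Z *m A *m Z^T) A')].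
Proof.
move=> Gu /submxP[D eD].
have Zf : row_free Z.
  apply: inj_row_free => v vZ; apply: (can_inj (mulmxK Gu)).
  by rewrite !mulmxA vZ !mul0mx.
pose K := kermx (A^T *m Z^T).
have rK : \rank K = (n - c)%N.
  by rewrite mxrank_ker eqmxMfull ?mxrank_tr ?(eqP Zf) // row_full_unit unitmx_tr.
have [V eV Vf] : exists2 V : 'M_(\rank K, n), (V :=: K)%MS & row_free V.
  by exists (row_base K); [apply: eq_row_base | apply: row_base_free].
have VAZ : V *m A^T *m Z^T = 0.
  by rewrite -mulmxA; apply/sub_kermxP; rewrite eV.
have ZAV : Z *m A *m V^T = 0.
  by apply: trmx_inj; rewrite !trmx_mul trmxK trmx0 mulmxA.
have VZ : V *m A *m Z^T = 0.
  apply: trmx_inj; rewrite !trmx_mul trmxK trmx0 -asym_mul.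
  by rewrite (mulmxA Z) (mulmxA Z asym) eD -(mulmxA D) -(mulmxA D) ZAV mulmx0.
have cn : (c <= n)%N by rewrite -(eqP Zf) rank_leq_col.
have Xf : row_free (col_mx Z V).
  rewrite /row_free -addsmxE; have := mxrank_sum_cap Z V.
  suff -> : (Z :&: V)%MS = 0 by rewrite mxrank0 addn0 (eqP Zf) (eqP Vf) => ->.
  apply/eqP; rewrite -submx0; apply/rV_subP=> v; rewrite sub_capmx.
  case/andP=> /submxP[a ->] /submxP[b e]; suff -> : a = 0 by rewrite mul0mx sub0mx.
  apply: (can_inj (mulmxK Gu)); rewrite !mulmxA e.
  by rewrite -(mulmxA b) -(mulmxA b) VZ mulmx0 !mul0mx.
have h : hcong A (dsum2 (Z *m A *m Z^T) (V *m A *m V^T)).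
  split; first by rewrite rK subnKC.
  exists (col_mx Z V) => //.
  by rewrite tr_col_mx !mul_col_mx !mul_mx_row ZAV VZ.
exists (\rank K), (V *m A *m V^T); split=> //; first by rewrite rK subnKC.
by have := hcong_unit h Au; rewrite dsum2_unit => /andP[].
Qed.

End Asymmetry.

(** * Splitting off a block (ii) whose eigenvalue has square other than 1 *)

Section HyperbolicPair.
Variables (F : fieldType).

Lemma jordan_unit k (lam : F) : lam != 0 -> jordan k lam \in unitmx.
Proof.
move=> lam0; rewrite -unitmx_tr unitmxE det_trig.
  rewrite (eq_bigr (fun=> lam)) => [|i _]; last by rewrite !mxE eqxx.
  by rewrite prodr_const unitfE expf_neq0.
apply/is_trig_mxP=> i j ij; rewrite !mxE gtn_eqF //.
by rewrite ifF //; lia.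
Qed.

Definition pairmx k (lam : F) : 'M[F]_(k + k) := block_mx 0 1%:M (jordan k lam) 0.

Lemma pairmx_unit k (lam : F) : lam != 0 -> pairmx k lam \in unitmx.
Proof.
move=> lam0; suff /mulmx1_unit[] : pairmx k lam *m
  block_mx 0 (invmx (jordan k lam)) 1%:M 0 = 1%:M by [].
rewrite mulmx_block !(mulmx0, mul0mx, mulmx1, addr0, add0r).
by rewrite mulmxV ?jordan_unit // -scalar_mx_block.
Qed.

(** The chain is listed from its last vector, so that the operator acts by the transposed Jordan
    block. *)
Lemma jordan_chain n (L : 'M[F]_n) lam k (x : 'rV_n) (X : 'M_(k, n)) :
  x *m (L - lam%:M) ^+ k = 0 ->
  (forall i, row i X = x *m (L - lam%:M) ^+ (k.-1 - i)) ->
  X *m L = (jordan k lam)^T *m X.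
Proof.
have [N eN] : exists N, N = L - lam%:M by eexists.
have -> : L = N + lam%:M by rewrite eN subrK.
rewrite addrK => xk eX; apply/row_matrixP=> i; rewrite row_mul [in RHS]row_mul eX.
rewrite mulmxDr -mulmxA -expmxSr mul_mx_scalar.
have -> : row i (jordan k lam)^T *m X = \sum_j ((jordan k lam) j i) *: row j X.
  by rewrite mulmx_sum_row; apply: eq_bigr => j _; rewrite !mxE.
rewrite (bigD1 i) //= mxE eqxx eX addrC; congr (_ + _).
case: i => -[|i] ik /=.
  rewrite subn0 (ltn_predK ik) xk big1 // => j; rewrite -val_eqE /= => j0.
  by rewrite mxE (negPf j0) /= scale0r.
have ik' : (i < k)%N by lia.
rewrite (bigD1 (Ordinal ik')) /=; last by rewrite -val_eqE /= ltn_eqF.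
rewrite mxE /= ltn_eqF // eqxx scale1r eX /= big1 ?addr0.
  by congr (_ *m _ ^+ _); lia.
move=> j /andP[]; rewrite -!val_eqE /= => j1 j2; rewrite mxE /=.
by rewrite (negPf j1) eqSS [i == j :> nat]eq_sym (negPf j2) scale0r.
Qed.

Variables (n : nat) (A : 'M[F]_n).
Hypothesis Au : A \in unitmx.
Local Notation M := (asym A).
Local Notation Mi := (asymV A).

(** The Gram matrix [P] of the two chains is triangular with nonzero diagonal, so the chain of [y]
    can be replaced by the basis dual to that of [x]. The Jordan block then arises in
    [Y *m A *m X^T] from the asymmetry. *)
Lemma pair_gram lam k (x y : 'rV_n) :
  x *m shift A lam ^+ k = 0 -> y *m shiftV A lam ^+ k = 0 ->
  bform A (x *m shift A lam ^+ k.-1) y != 0 ->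
  (forall i j, bform A (x *m shift A lam ^+ i) (x *m shift A lam ^+ j) = 0) ->
  (forall i j, bform A (y *m shiftV A lam ^+ i) (y *m shiftV A lam ^+ j) = 0) ->
  exists2 Z : 'M_(k + k, n), Z *m A *m Z^T = pairmx k lam & (Z *m M <= Z)%MS.
Proof.
move=> xk yk xy xx yy.
have [X eX] : exists X : 'M_(k, n),
    forall i, row i X = x *m shift A lam ^+ (k.-1 - i).
  exists (\matrix_(i < k) (x *m shift A lam ^+ (k.-1 - i))) => i.
  by rewrite rowK.
have [Y0 eY0] : exists Y : 'M_(k, n), forall i, row i Y = y *m shiftV A lam ^+ i.
  exists (\matrix_(i < k) (y *m shiftV A lam ^+ i)) => i.
  by rewrite rowK.
have XM : X *m M = (jordan k lam)^T *m X by apply: jordan_chain eX.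
pose P := X *m A *m Y0^T.
have PE i j : P i j = bform A (x *m shift A lam ^+ (k.-1 - i + j)) y.
  by rewrite gramE eX eY0 -bform_shift // -mulmxA -expmxD.
have Pu : P \in unitmx.
  rewrite unitmxE det_trig.
    rewrite unitfE; apply/prodf_neq0 => i _; rewrite PE subnK //.
    by have := ltn_ord i; lia.
  apply/is_trig_mxP=> i j ij; rewrite PE (mul_expmx_leq0 _ xk) ?bform0l //.
  by have := ltn_ord j; lia.
have [Y eY] : exists Y, Y = (invmx P)^T *m Y0 by eexists.
have Y0E : Y0 = P^T *m Y by rewrite eY trmx_inv mulKVmx // unitmx_tr.
have XY : X *m A *m Y^T = 1%:M.
  by rewrite eY trmx_mul trmxK mulmxA -/P mulmxV.
have XX : X *m A *m X^T = 0.
  by apply/matrixP=> i j; rewrite gramE !eX xx mxE.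
have YY : Y *m A *m Y^T = 0.
  have YY0 : Y0 *m A *m Y0^T = 0.
    by apply/matrixP=> i j; rewrite gramE !eY0 yy mxE.
  have -> : Y *m A *m Y^T = (invmx P)^T *m (Y0 *m A *m Y0^T) *m invmx P.
    by rewrite eY trmx_mul trmxK !mulmxA.
  by rewrite YY0 mulmx0 mul0mx.
have YX : Y *m A *m X^T = jordan k lam.
  apply: trmx_inj; rewrite !trmx_mul trmxK -(asym_mul Au).
  by rewrite (mulmxA X) (mulmxA X M) XM -!(mulmxA _^T) XY mulmx1.
exists (col_mx X Y).
  by rewrite tr_col_mx !mul_col_mx !mul_mx_row XX XY YX YY.
rewrite mul_col_mx -!addsmxE; apply: addsmxS; first by rewrite XM submxMl.
have eqY : (Y :=: Y0)%MS.
  by rewrite eY; apply/eqmxMfull; rewrite row_full_unit unitmx_tr unitmx_inv.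
apply: stable_asym => //; rewrite (eqmxMr _ eqY) eqY.
apply/row_subP=> i; rewrite row_mul eY0.
have -> : Mi = shiftV A lam + lam%:M by rewrite subrK.
rewrite mulmxDr -mulmxA -expmxSr mul_mx_scalar -eY0.
rewrite addmx_sub ?scalemx_sub ?row_sub //.
have [ik|ki] := ltnP i.+1 k; last by rewrite (mul_expmx_leq0 ki yk) sub0mx.
by rewrite -[i.+1]/(nat_of_ord (Ordinal ik)) -eY0 row_sub.
Qed.

(** Downward induction on [i + j]: applying [K] to both arguments multiplies the value by
    [lam ^+ 2], up to terms of larger exponent sum, which vanish already. *)
Lemma isometry_isotropic (K : 'M[F]_n) lam k (x : 'rV_n) :
  K *m A *m K^T = A -> lam ^+ 2 != 1 -> x *m (K - lam%:M) ^+ k = 0 ->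
  forall i j, bform A (x *m (K - lam%:M) ^+ i) (x *m (K - lam%:M) ^+ j) = 0.
Proof.
move=> KK lam1 xk i j; set N := K - lam%:M in xk *.
have [d] := ubnP (k + k - (i + j)); elim: d i j => // d IH i j ijd.
have [ki|ik] := leqP k i; first by rewrite (mul_expmx_leq0 ki xk) bform0l.
have [kj|jk] := leqP k j; first by rewrite (mul_expmx_leq0 kj xk) bform0r.
have step l : x *m N ^+ l *m K = lam *: (x *m N ^+ l) + x *m N ^+ l.+1.
  have {1}-> : K = lam%:M + N by rewrite addrC subrK.
  by rewrite mulmxDr mul_mx_scalar expmxSr mulmxA.
have : bform A (x *m N ^+ i *m K) (x *m N ^+ j *m K) =
       bform A (x *m N ^+ i) (x *m N ^+ j).
  by rewrite /bform trmx_mul -{2}KK !mulmxA.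
rewrite !step !(bformDl, bformDr, bformZl, bformZr) !(IH i.+1) ?(IH i j.+1); try lia.
rewrite !mulr0 !addr0 mulrA -expr2 => /eqP; rewrite -subr_eq0 -{2}[bform _ _ _]mul1r.
by rewrite -mulrBl mulf_eq0 subr_eq0 (negPf lam1) => /eqP.
Qed.

Lemma asym_isometry : M *m A *m M^T = A.
Proof.
rewrite (asym_mul Au); apply: trmx_inj.
by rewrite trmx_mul !trmxK (asym_mul Au).
Qed.

Lemma asymV_isometry : Mi *m A *m Mi^T = A.
Proof.
rewrite -(mulmxA Mi) (mul_asymV_tr Au) -(asym_mul Au) mulmxA asymVK //.
by rewrite mul1mx.
Qed.

Lemma rank_stabilizes (N : 'M[F]_n) : exists k, \rank (N ^+ k) == \rank (N ^+ k.+1).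
Proof.
have [/existsP[k ek]|] := boolP [exists k : 'I_n.+1, \rank (N ^+ k) == \rank (N ^+ k.+1)].
  by exists k.
rewrite negb_exists => /forallP h.
have {}h k : (k <= n.+1)%N -> (\rank (N ^+ k) + k <= n)%N.
  elim: k => [_|k IH kn]; first by rewrite addn0 rank_leq_row.
  have := h (Ordinal kn); rewrite /= => ne.
  have : (\rank (N ^+ k.+1) <= \rank (N ^+ k))%N by rewrite expmxS mxrankM_maxr.
  by have := IH (ltnW kn); lia.
by have := h n.+1 (leqnn _); lia.
Qed.

Lemma pair_vectors lam : lam != 0 -> lam ^+ 2 != 1 -> eigenvalue M lam ->
  exists k x y, [/\ (0 < k)%N, x *m shift A lam ^+ k = 0,
    y *m shiftV A lam ^+ k = 0 & bform A (x *m shift A lam ^+ k.-1) y != 0].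
Proof.
move=> lam0 lam1 ev; set N := shift A lam; set T := shiftV A lam.
(* [k.+1] is the first exponent from which the kernels of the powers of [N] stop growing; the
   eigenvalue excludes exponent 0. *)
case: (ex_minnP (rank_stabilizes N)) => -[|k].
  rewrite expmx0 expmx1 mxrank1 => /eqP rk _; case/negP: ev.
  rewrite kermx_eq0 /row_free -rk //.
move=> rk kmin; have {}kmin : (\rank (N ^+ k.+1) < \rank (N ^+ k))%N.
  rewrite ltn_neqAle expmxS mxrankM_maxr andbT -expmxS eq_sym.
  by apply/negP => /kmin; rewrite ltnn.
have kerS : (kermx (N ^+ k.+2) <= kermx (N ^+ k.+1))%MS.
  have le : (kermx (N ^+ k.+1) <= kermx (N ^+ k.+2))%MS.
    by apply/sub_kermxP; rewrite (expmxSr N k.+1) mulmxA mulmx_ker mul0mx.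
  have := mxrank_leqif_eq le; rewrite !mxrank_ker (eqP rk) => -[_].
  by rewrite eqxx => /esym/eqmxP <-.
have /row_subPn[i hi] : ~~ (kermx (N ^+ k.+1) <= kermx (N ^+ k))%MS.
  apply/negP => /mxrankS; rewrite !mxrank_ker.
  by have := rank_leq_row (N ^+ k); lia.
set x := row i _ in hi; have xk : x *m N ^+ k.+1 = 0.
  by rewrite -row_mul mulmx_ker row0.
have z0 : x *m N ^+ k != 0 by rewrite -sub_kermx.
(* Were [x *m N ^+ k] orthogonal to all of [kermx (T ^+ k.+1)], it would equal some
   [w *m N ^+ k.+1]. Then [w] would lie in the kernel of [N ^+ k.+2], which is that of [N ^+ k.+1],
   and [x *m N ^+ k] would be zero. *)
have : x *m N ^+ k *m A *m (kermx (T ^+ k.+1))^T != 0.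
  apply: contra z0 => /eqP zA.
  have := @kermx_mul_eq0 _ _ _ _ (T ^+ k.+1) (x *m N ^+ k *m A)^T.
  rewrite -[kermx _]trmxK -trmx_mul zA trmx0 => /(_ erefl).
  move/(congr1 trmx); rewrite trmx_mul trmxK; move: (_^T) => v vE.
  have zE : x *m N ^+ k = v *m invmx A *m N ^+ k.+1.
    apply: (can_inj (mulmxK Au)); rewrite -vE -(mulmxA (v *m _)).
    by rewrite exp_shift_adjoint // mulmxA mulmxKV.
  have : (v *m invmx A <= kermx (N ^+ k.+2))%MS.
    by apply/sub_kermxP; rewrite expmxSr mulmxA -zE -mulmxA -expmxSr.
  by move/submx_trans/(_ kerS); rewrite sub_kermx -zE.
case/matrix0Pn => a [j]; rewrite ord1 gramE row_id => xy.
exists k.+1, x, (row j (kermx (T ^+ k.+1))); split=> //.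
by rewrite -row_mul mulmx_ker row0.
Qed.

Lemma split_pair lam : lam != 0 -> lam ^+ 2 != 1 -> eigenvalue M lam ->
  exists k m (A' : 'M[F]_m), [/\ (0 < k)%N, (k + k + m)%N = n, A' \in unitmx &
    hcong A (dsum2 (pairmx k lam) A')].
Proof.
move=> lam0 lam1 ev; have [k [x [y [k0 xk yk xy]]]] := pair_vectors lam0 lam1 ev.
have [||Z ZZ ZM] := pair_gram xk yk xy.
- exact: isometry_isotropic asym_isometry lam1 xk.
- exact: isometry_isotropic asymV_isometry lam1 yk.
have [|m [A' [e A'u h]]] := split_off Au _ ZM; first by rewrite ZZ pairmx_unit.
by exists k, m, A'; rewrite -ZZ.
Qed.

End HyperbolicPair.

(** * Unipotent cosquares in characteristic two *)

Section CharTwo.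
Variable F : closedFieldType.
Hypothesis char2 : (2 \in [pchar F])%N.

Lemma addvv2 (V : lmodType F) (v : V) : v + v = 0.
Proof.
rewrite -mulr2n -scaler_nat; have/andP[_ /eqP ->] := char2; exact: scale0r.
Qed.

Lemma oppv2 (V : lmodType F) (v : V) : - v = v.
Proof. by apply/esym/eqP; rewrite -subr_eq0 opprK addvv2. Qed.

Lemma addff2 (a : F) : a + a = 0.
Proof. exact: (@addvv2 F^o). Qed.

(** For [a = 0] the equation is linear in [t], whence the condition on [b]. *)
Lemma quadratic_root (a b c : F) : b != 0 -> exists t, c + t ^+ 2 * a + t * b = 0.
Proof.
move=> b0; have [a0|a0] := eqVneq a 0.
  by exists (- (c / b)); rewrite a0 mulr0 addr0 mulNr divfK // subrr.
have [t] := @solve_monicpoly F 2 (fun i => if i == 0%N then - (c / a) else - (b / a)) isT.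
rewrite !big_ord_recr big_ord0 /= expr0 expr1 add0r mulr1 => e; exists t.
by rewrite e; field.
Qed.

Lemma sqrt_exists (a : F) : exists t, t ^+ 2 = a.
Proof.
have [t] := @solve_monicpoly F 2 (fun i => if i == 0%N then a else 0) isT.
rewrite !big_ord_recr big_ord0 /= expr0 expr1 add0r mulr1 mul0r addr0 => e.
by exists t.
Qed.

(* With [M] the cosquare acting on rows, [N = M - 1] and [s = M + M^-1], every
   polynomial in [M] is a combination of the [s ^ i] and the [s ^ i N], and the
   adjoint of [N] is [M^-1 - 1 = N + s]. *)
Record nilpair n (A N s : 'M[F]_n) : Prop := Nilpair {
  nilpair_comm : N *m s = s *m N;
  nilpair_sqr : N *m N = s + N *m s;
  nilpair_adjN : forall x y, bform A (x *m N) y = bform A x (y *m (N + s));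
  nilpair_adjs : forall x y, bform A (x *m s) y = bform A x (y *m s);
  nilpair_swap : forall x y, bform A y x = bform A (x *m N) y + bform A x y }.

Lemma asym_nilpair n (A : 'M[F]_n) : A \in unitmx ->
  exists s, nilpair A (shift A 1) s /\ shiftV A 1 = shift A 1 + s.
Proof.
move=> Au.
have [N eN] : exists N, N = shift A 1 by eexists.
have [T eT] : exists T, T = shiftV A 1 by eexists.
(* The product [N *m T] is [- N - T], which is the sum of the asymmetry and its inverse in
   characteristic two. *)
have [s es] : exists s, s = N *m T by eexists.
have TE : T = N + s.
  have -> : s = - N - T.
    by rewrite es eN mulmxBl mul1mx {1}eT mulmxBr asymK // mulmx1 opprB.
  by rewrite addrA subrr sub0r oppv2.
have NT : N *m T = T *m N.
  rewrite eN eT !(mulmxBl, mulmxBr) asymK // asymVK // !(mulmx1, mul1mx) !opprB.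
  exact: addrC.
have TA : T *m A = A *m N^T.
  rewrite eT eN mulmxBl linearB /= trmx_asym mulmxBr tr_scalar_mx scalar_mxC.
  by rewrite /cosquare /asymV mulmxA.
have NA : N *m A = A *m T^T by rewrite eN eT shift_adjoint.
have sA : s *m A = A *m s^T.
  by rewrite es -mulmxA TA mulmxA NA -mulmxA -trmx_mul.
exists s; rewrite -eN -eT; split=> //; split.
- by rewrite es {1}NT mulmxA.
- by rewrite {1}es TE mulmxDr -addrA addvv2 addr0.
- by move=> x y; rewrite -TE /bform -(mulmxA x) NA trmx_mul !mulmxA.
- by move=> x y; rewrite /bform -(mulmxA x) sA trmx_mul !mulmxA.
- move=> x y; rewrite -(bform_asym Au) -bformDl; congr (bform _ _ _).
  by rewrite eN mulmxBr mulmx1 subrK.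
Qed.

Variables (n : nat) (A N s : 'M[F]_n).
Hypothesis NP : nilpair A N s.
Local Notation f := (bform A).

Lemma comm_exp_s i : N *m s ^+ i = s ^+ i *m N.
Proof.
elim: i => [|i IH]; first by rewrite !expmx0 mulmx1 mul1mx.
by rewrite expmxS mulmxA (nilpair_comm NP) -mulmxA IH mulmxA.
Qed.

Lemma bform_s i x y : f (x *m s ^+ i) y = f x (y *m s ^+ i).
Proof.
elim: i x y => [|i IH] x y; first by rewrite !expmx0 !mulmx1.
by rewrite {1}expmxSr (mulmxA x) (nilpair_adjs NP) IH -mulmxA -expmxS.
Qed.

Lemma bform_sDl i j x y : f (x *m s ^+ i) (y *m s ^+ j) = f (x *m s ^+ (i + j)) y.
Proof. by rewrite -bform_s -mulmxA -expmxD. Qed.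

(** The adjoint [N + s] multiplied by [N] is [s] in characteristic two. *)
Lemma bform_NN x y : f (x *m N) (y *m N) = f (x *m s) y.
Proof.
rewrite (nilpair_adjN NP) mulmxDr -!mulmxA (nilpair_sqr NP) mulmxDr.
by rewrite -addrA addvv2 addr0 (nilpair_adjs NP).
Qed.

(** The polar forms are alternating: the swap rule at [x *m s ^+ i] and [x] has equal outer terms
    because [s] is self-adjoint. *)
Lemma bform_N_self i x : f (x *m s ^+ i *m N) x = 0.
Proof.
have := nilpair_swap NP (x *m s ^+ i) x.
by rewrite bform_s => /eqP; rewrite -subr_eq0 opprD addrCA subrr addr0 oppr_eq0 => /eqP.
Qed.

Lemma bform_N_r x y : f x (y *m N) = f (y *m N) x + f (x *m s) y.
Proof.
rewrite (nilpair_swap NP (y *m N)) -mulmxA (nilpair_sqr NP) mulmxDr bformDl.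
rewrite (nilpair_comm NP) mulmxA [X in X + _]addrC -(nilpair_swap NP (y *m s)).
by rewrite addrC (nilpair_adjs NP).
Qed.

Definition qform i (x : 'rV_n) : F := f (x *m s ^+ i) x.

Lemma qformD i x y : qform i (x + y) = qform i x + qform i y + f (x *m s ^+ i *m N) y.
Proof.
rewrite /qform mulmxDl !(bformDl, bformDr) -!addrA; congr (_ + _).
have -> : f (y *m s ^+ i) x = f (x *m s ^+ i *m N) y + f (x *m s ^+ i) y.
  by rewrite bform_s (nilpair_swap NP).
by rewrite [X in _ + (X + _)]addrC -!addrA addrA addff2 add0r addrC.
Qed.

Lemma qformZ i a x : qform i (a *: x) = a ^+ 2 * qform i x.
Proof. by rewrite /qform -scalemxAl bformZl bformZr mulrA. Qed.

Lemma qform_s i j x : qform i (x *m s ^+ j) = qform (i + (j + j)) x.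
Proof. by rewrite /qform -mulmxA -expmxD bform_sDl addnAC addnA addnC addnA. Qed.

Lemma qform_sN i j x : qform i (x *m s ^+ j *m N) = qform (i + (j + j)).+1 x.
Proof.
rewrite /qform -(mulmxA _ N) comm_exp_s mulmxA bform_NN.
rewrite -!(mulmxA x) -expmxD -expmxSr bform_sDl.
by congr (f (_ *m _ ^+ _) _); lia.
Qed.

(* Scaling and correcting by [c s ^ j N] changes [qform (m - j - 1)] by
   [c + c ^ 2 qform (m + j)] and leaves the higher ones unchanged. *)
Lemma sq_normalize m x0 : (forall i x, (m < i)%N -> qform i x = 0) ->
  qform m x0 != 0 ->
  exists x, forall i, qform i x = (i == m)%:R.
Proof.
move=> qbig q0; suff : forall d, exists x, qform m x = 1 /\
    forall i, (m < i + d.+1)%N -> i != m -> qform i x = 0.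
  move=> /(_ m) [x [qm qx]]; exists x => i; case: eqP => [->//|/eqP im].
  by rewrite qx // leq_addl.
elim=> [|d [x [qm qx]]].
  have [c ec] := sqrt_exists (qform m x0)^-1; exists (c *: x0).
  rewrite qformZ ec mulVf //; split=> // i; rewrite addn1 ltnS => mi im.
  by rewrite qformZ qbig ?mulr0 // ltn_neqAle eq_sym im.
have [dm|md] := ltnP d m; last first.
  by exists x; split=> // i _ im; apply: qx => //; lia.
(* [i0] is the next index to be cleared; its linear coefficient is [qform m x], which is 1, so the
   quadratic equation has a root. *)
pose i0 := (m - d.+1)%N; have i0E : (i0 + d.+1)%N = m by rewrite subnK.
have QE c i : qform i (x + c *: (x *m s ^+ d *m N)) =
    qform i x + c ^+ 2 * qform (i + (d + d)).+1 x + c * qform (i + d.+1) x.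
  rewrite qformD qformZ qform_sN bformZr bform_NN -mulmxA -expmxSr.
  by rewrite bform_sDl addSnnS.
have [c ec] : exists c, qform i0 x + c ^+ 2 * qform (i0 + (d + d)).+1 x
    + c * qform (i0 + d.+1) x = 0.
  by apply: quadratic_root; rewrite i0E qm oner_eq0.
exists (x + c *: (x *m s ^+ d *m N)); split=> [|i].
  by rewrite QE !(qbig (m + _)%N) ?(qbig (m + _).+1) ?mulr0 ?addr0 //; lia.
have [-> _ _|ii0 mi im] := eqVneq i i0; first by rewrite QE ec.
have mi' : (m < i + d.+1)%N by lia.
by rewrite QE (qx i) // (qbig (i + _)%N) // qx ?mulr0 ?addr0 //; lia.
Qed.

(* The correction of [x] by multiples of the [u j], of which [r] records the
   values of [q], is triangular in [i] because the polar form [b] vanishes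
   above [m]. *)
Lemma isotropize (q : nat -> 'rV[F]_n -> F) (b : nat -> 'rV_n -> F)
    (u : nat -> 'rV_n) (r : nat -> F) m d x0 :
  (forall i j c x, q i (x + c *: u j) =
     q i x + c ^+ 2 * r (i + (j + j) + d)%N + c * b (i + j + d)%N x) ->
  (forall l x, (m < l)%N -> b l x = 0) ->
  (forall j c x, b m (x + c *: u j) = b m x) ->
  (forall i x, (m < i + d)%N -> q i x = 0) ->
  (forall i, (m < i + d)%N -> r i = 0) ->
  b m x0 != 0 ->
  exists x, b m x = b m x0 /\ forall i, q i x = 0.
Proof.
move=> qE bbig bu qbig rbig b0; suff : forall t, exists x, b m x = b m x0 /\
    forall i, (m < i + d + t)%N -> q i x = 0.
  move=> /(_ m.+1) [x [bx qx]]; exists x; split=> // i; apply: qx; lia.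
elim=> [|t [x [bx qx]]].
  by exists x0; split=> // i; rewrite addn0; apply: qbig.
have [dm|md] := leqP (d + t) m; last first.
  by exists x; split=> // i _; apply: qx; lia.
(* The largest index not yet treated; the linear coefficient there is [b m x], nonzero and preserved
   by every correction. *)
pose i0 := (m - (d + t))%N.
have [c ec] : exists c, q i0 x + c ^+ 2 * r (i0 + (t + t) + d)%N
    + c * b (i0 + t + d)%N x = 0.
  have -> : (i0 + t + d)%N = m by rewrite /i0; lia.
  by apply: quadratic_root; rewrite bx.
exists (x + c *: u t); split=> [|i]; first by rewrite bu.
have [-> _|ii0 mi] := eqVneq i i0; first by rewrite qE ec.
rewrite qE qx ?rbig ?bbig ?mulr0 ?addr0 //; lia.
Qed.

End CharTwo.

(** * The Gram matrix of a block (iii) in an adapted basis *)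

Section StandardOddBlock.
Variable F : fieldType.

Definition exchange p : 'M[F]_p := \matrix_(i, j) ((i + j.+1)%N == p)%:R.

Lemma exchange_unit p : exchange p \in unitmx.
Proof.
suff /mulmx1_unit[] : exchange p *m exchange p = 1%:M by [].
apply/matrixP=> i j; rewrite !mxE (bigD1 (rev_ord i)) //= !mxE.
have -> : (i + (rev_ord i).+1 == p)%N by rewrite /=; apply/eqP; have := ltn_ord i; lia.
rewrite mul1r big1 ?addr0 => [|k ki].
  congr (_ %:R); rewrite -val_eqE /=; congr nat_of_bool.
  by apply/eqP/eqP; have := ltn_ord i; have := ltn_ord j; lia.
rewrite !mxE; case: eqP => [e|_]; last by rewrite mul0r.
by case/eqP: ki; apply: val_inj => /=; lia.
Qed.

(* The Gram matrix of the family x s^i (i <= m), x s^i N (i < m) for a vector x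
   normalised by [qform i x = (i == m)]. *)
Definition stdmx m : 'M[F]_(m.+1 + m) :=
  block_mx (exchange m.+1) (\matrix_(i, j) ((i + j.+1)%N == m)%:R) 0 (exchange m).

Lemma stdmx_unit m : stdmx m \in unitmx.
Proof.
by rewrite unitmxE det_ublock unitrM -!unitmxE !exchange_unit.
Qed.

End StandardOddBlock.

(** * Cyclic modules under a unipotent cosquare *)

Section Unipotent.
Variable F : closedFieldType.
Hypothesis char2 : (2 \in [pchar F])%N.

Section Nilpair.
Variables (n : nat) (A N s : 'M[F]_n).
Hypothesis NP : nilpair A N s.
Local Notation f := (bform A).
Local Notation Q := (qform A s).

(** Multiplication by [N] or by its adjoint [N + s] preserves the span of the [s ^+ l] and
    [s ^+ l *m N]. Their values at [x] are [Q l x] and an alternating form at [x], both zero. *)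
Lemma isotropic_word (x : 'rV_n) (K : 'M[F]_n) :
  (forall l, Q l x = 0) ->
  (exists i j, K = N ^+ i *m (N + s) ^+ j) -> f (x *m K) x = 0.
Proof.
move=> Qx; pose P (K : 'M[F]_n) := forall l,
  f (x *m K *m s ^+ l) x = 0 /\ f (x *m K *m N *m s ^+ l) x = 0.
have P1 : P 1%:M.
  move=> l; rewrite mulmx1 -mulmxA (comm_exp_s NP) mulmxA (bform_N_self NP).
  by split=> //; apply: Qx.
have PN L : P L -> P (L *m N).
  move=> PL l; have [h1 h2] := PL l.+1; have [_ h3] := PL l.
  split; first by rewrite mulmxA h3.
  rewrite mulmxA -(mulmxA _ N N) (nilpair_sqr NP) mulmxDr mulmxDl mulmxA.
  by rewrite -!(mulmxA _ s) -expmxS bformDl h1 h2 addr0.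
have PT L : P L -> P (L *m (N + s)).
  move=> PL l; have [h1 h2] := PL l.+1; have [_ h3] := PL l.
  split.
    rewrite mulmxDr mulmxDr mulmxDl bformDl !mulmxA h3 add0r.
    by rewrite -mulmxA -expmxS h1.
  have e : (N + s) *m N = s.
    by rewrite mulmxDl (nilpair_sqr NP) (nilpair_comm NP) -addrA addvv2 // addr0.
  by rewrite !mulmxA -(mulmxA _ _ N) e -mulmxA -expmxS h1.
case=> i [j ->]; have : P (N ^+ i *m (N + s) ^+ j).
  elim: j => [|j IH]; last by rewrite expmxSr mulmxA; apply: PT.
  rewrite expmx0 mulmx1; elim: i => [|i IH]; first by rewrite expmx0.
  by rewrite expmxSr; apply: PN.
by move/(_ 0)=> [+ _]; rewrite expmx0 mulmx1.
Qed.

(** The relation for [N *m N] reads [s *m (N + 1%:M)]. Since [N + 1%:M] is the invertible asymmetry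
    in the application, [s ^+ i] and [N ^+ (i + i)] have the same kernel. *)
Lemma exp_shift_s i : N ^+ (i + i) = s ^+ i *m (N + 1%:M) ^+ i.
Proof.
have cN : (N + 1%:M) *m s = s *m (N + 1%:M).
  by rewrite mulmxDl mulmxDr (nilpair_comm NP) mul1mx mulmx1.
have cNi j : (N + 1%:M) ^+ j *m s = s *m (N + 1%:M) ^+ j.
  elim: j => [|j IH]; first by rewrite expmx0 mul1mx mulmx1.
  by rewrite expmxSr -mulmxA cN mulmxA IH -mulmxA.
elim: i => [|i IH]; first by rewrite !expmx0 mulmx1.
rewrite addSn addnS 2!expmxSr IH -mulmxA (nilpair_sqr NP) expmxSr expmxSr.
rewrite -!mulmxA; congr (_ *m _).
rewrite (mulmxA s) -cNi -mulmxA; congr (_ *m _).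
by rewrite mulmxDr mulmx1 addrC (nilpair_comm NP).
Qed.

Lemma bform_sN_s i j x : f (x *m s ^+ i *m N) (x *m s ^+ j) = 0.
Proof.
rewrite -(bform_s NP) -(mulmxA _ N) (comm_exp_s NP) mulmxA -(mulmxA x) -expmxD.
exact: bform_N_self.
Qed.

Hypothesis Nu : N + 1%:M \in unitmx.

Lemma mul_exp_s_eq0 (x : 'rV_n) i : (x *m s ^+ i == 0) = (x *m N ^+ (i + i) == 0).
Proof.
rewrite exp_shift_s mulmxA [RHS]mulmx_free_eq0 //.
by rewrite row_free_unit expmx_unit.
Qed.

Lemma mul_exp_sN_eq0 (x : 'rV_n) i :
  (x *m s ^+ i *m N == 0) = (x *m N ^+ (i + i).+1 == 0).
Proof.
by rewrite -mulmxA -(comm_exp_s NP) mulmxA mul_exp_s_eq0 -mulmxA -expmxS.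
Qed.

Lemma mul_exp_s_id (x : 'rV_n) i :
  x *m N ^+ (i + i).+1 = 0 -> x *m N ^+ (i + i) = x *m s ^+ i.
Proof.
move/eqP; rewrite -mul_exp_sN_eq0 exp_shift_s mulmxA => /eqP.
move: (x *m _) => y yN; elim: {x} i => [|j IH]; first by rewrite expmx0 mulmx1.
by rewrite expmxS mulmxA mulmxDr yN add0r mulmx1 IH.
Qed.

(** The vanishing of [x *m s ^+ m *m N], together with the relation for [N *m N], closes the family
    of the [x *m s ^+ i] and [x *m s ^+ i *m N] under [N]. *)
Lemma sq_gram m (x : 'rV_n) : (forall i, Q i x = (i == m)%:R) ->
  x *m s ^+ m *m N = 0 ->
  exists2 Z : 'M_(m.+1 + m, n), Z *m A *m Z^T = stdmx F m
    & (Z *m (N + 1%:M) <= Z)%MS.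
Proof.
move=> Qx xN.
have [X eX] : exists X : 'M_(m.+1, n), forall i, row i X = x *m s ^+ i.
  by exists (\matrix_(i < m.+1) (x *m s ^+ i)) => i; rewrite rowK.
have [Y eY] : exists Y : 'M_(m, n), forall i, row i Y = x *m s ^+ i *m N.
  by exists (\matrix_(i < m) (x *m s ^+ i *m N)) => i; rewrite rowK.
exists (col_mx X Y).
  rewrite tr_col_mx !mul_col_mx !mul_mx_row; congr (col_mx (row_mx _ _) (row_mx _ _)).
  - apply/matrixP=> i j; rewrite gramE !eX (bform_sDl NP) -/(qform _ _ _ _) Qx mxE.
    by congr (_ %:R); rewrite addnS eqSS.
  - apply/matrixP=> i j; rewrite gramE eX eY (bform_N_r NP) bform_sN_s add0r.
    by rewrite -mulmxA -expmxSr (bform_sDl NP) -/(qform _ _ _ _) Qx mxE addSnnS.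
  - by apply/matrixP=> i j; rewrite gramE eX eY mxE bform_sN_s.
  - apply/matrixP=> i j; rewrite gramE !eY (bform_NN char2 NP) -mulmxA -expmxSr.
    by rewrite (bform_sDl NP) -/(qform _ _ _ _) Qx mxE addSnnS.
rewrite mulmxDr mulmx1 addmx_sub // mul_col_mx -addsmxE.
have Xs i : (i <= m)%N -> (x *m s ^+ i <= col_mx X Y)%MS.
  move=> im; rewrite -[i]/(nat_of_ord (Ordinal (im : i < m.+1)%N)) -eX -addsmxE.
  by apply: submx_trans (addsmxSl _ _); apply: row_sub.
have Ys i : (i <= m)%N -> (x *m s ^+ i *m N <= col_mx X Y)%MS.
  rewrite leq_eqVlt => /orP[/eqP->|im]; first by rewrite xN sub0mx.
  rewrite -[i]/(nat_of_ord (Ordinal im)) -eY -addsmxE.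
  by apply: submx_trans (addsmxSr _ _); apply: row_sub.
rewrite addsmx_sub; apply/andP; split; apply/row_subP=> i; rewrite row_mul.
  by rewrite eX Ys // -ltnS.
rewrite eY -(mulmxA _ N N) (nilpair_sqr NP) mulmxDr (nilpair_comm NP) mulmxA.
by rewrite -!(mulmxA x) -expmxSr mulmxA addmx_sub ?Xs ?Ys.
Qed.

End Nilpair.
End Unipotent.

(** * Splitting a form with unipotent cosquare *)

Section UnipotentSplit.
Variable F : closedFieldType.
Hypothesis char2 : (2 \in [pchar F])%N.

Section Vectors.
Variables (n : nat) (A N s : 'M[F]_n).
Hypothesis NP : nilpair A N s.
Hypothesis Nu : N + 1%:M \in unitmx.
Local Notation f := (bform A).
Local Notation Q := (qform A s).

Lemma exp_s_leq0 i j : N ^+ i = 0 -> (i <= j + j)%N -> forall x : 'rV_n, x *m s ^+ j = 0.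
Proof.
move=> Ni ij x; apply/eqP; rewrite (mul_exp_s_eq0 NP Nu).
by rewrite (expmx_leq0 ij Ni) mulmx0.
Qed.

Lemma exp_sN_leq0 i j : N ^+ i = 0 -> (i <= (j + j).+1)%N ->
  forall x : 'rV_n, x *m s ^+ j *m N = 0.
Proof.
move=> Ni ij x; apply/eqP; rewrite (mul_exp_sN_eq0 NP Nu).
by rewrite (expmx_leq0 ij Ni) mulmx0.
Qed.

Lemma polar_sym i x y : f (x *m s ^+ i *m N) y = f (y *m s ^+ i *m N) x.
Proof.
have := qformD char2 NP i x y; rewrite addrC (qformD char2 NP) [Q i y + _]addrC.
by move/addrI.
Qed.

(** The corrections are the [y *m s ^+ j]. Nilpotency kills [Q i] for [i > m], and the pairing with
    [y] is preserved because the polar forms are alternating. *)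
Lemma isotropic_even m (x y : 'rV_n) : N ^+ m.+1.*2 = 0 ->
  f (x *m s ^+ m *m N) y != 0 ->
  exists x', f (x' *m s ^+ m *m N) y = f (x *m s ^+ m *m N) y /\ forall i, Q i x' = 0.
Proof.
move=> N0; pose b l z := f (z *m s ^+ l *m N) y.
have qbig i z : (m < i + 0)%N -> Q i z = 0.
  by move=> mi; rewrite /qform (exp_s_leq0 N0) ?bform0l //; lia.
apply: (isotropize (q := Q) (b := b) (u := fun j => y *m s ^+ j)
  (r := fun i => Q i y) (d := 0) char2); rewrite /b => //.
- move=> i j c z; rewrite (qformD char2 NP) qformZ (qform_s NP) bformZr !addn0.
  congr (_ + _ * _); rewrite -(bform_s NP) -(mulmxA _ N) (comm_exp_s NP) !mulmxA.
  by rewrite -(mulmxA z) -expmxD.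
- by move=> l z ml; rewrite (exp_sN_leq0 N0) ?bform0l //; lia.
- move=> j c z; rewrite !mulmxDl -!scalemxAl bformDl bformZl.
  by rewrite -(mulmxA y) -expmxD (bform_N_self NP) mulr0 addr0.
- by move=> i; apply: qbig.
Qed.

(** Here the corrections are the [y *m s ^+ j *m N]. They cannot change [Q m], which is why it is
    assumed to vanish. *)
Lemma isotropic_odd m (x y : 'rV_n) : N ^+ m.*2.+1 = 0 -> (forall z, Q m z = 0) ->
  f (x *m s ^+ m) y != 0 ->
  exists x', f (x' *m s ^+ m) y = f (x *m s ^+ m) y /\ forall i, Q i x' = 0.
Proof.
move=> N0 Qm; pose b l z := f (z *m s ^+ l) y.
have qbig i z : (m < i + 1)%N -> Q i z = 0.
  rewrite addn1 ltnS leq_eqVlt => /orP[/eqP<- // | mi].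
  by rewrite /qform (exp_s_leq0 N0) ?bform0l //; lia.
apply: (isotropize (q := Q) (b := b) (u := fun j => y *m s ^+ j *m N)
  (r := fun i => Q i y) (d := 1) char2); rewrite /b => //.
- move=> i j c z; rewrite (qformD char2 NP) qformZ (qform_sN char2 NP) bformZr !addn1.
  by rewrite (bform_NN char2 NP) -(mulmxA z) -expmxSr (bform_sDl NP) addSn.
- by move=> l z ml; rewrite (exp_s_leq0 N0) ?bform0l //; lia.
- move=> j c z; rewrite !mulmxDl -!scalemxAl bformDl bformZl.
  by rewrite (bform_s NP m (_ *m N)) (bform_sN_s NP) mulr0 addr0.
- by move=> i; apply: qbig.
Qed.

Lemma bform_adjT j x y : f (x *m (N + s) ^+ j) y = f x (y *m N ^+ j).
Proof.
elim: j x y => [|j IH] x y; first by rewrite !expmx0 !mulmx1.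
rewrite expmxSr mulmxA mulmxDr bformDl (nilpair_adjN NP) (nilpair_adjs NP) mulmxDr.
by rewrite bformDr -addrA (addff2 char2) addr0 IH -mulmxA -expmxS.
Qed.

Lemma comm_word i j : (N + s) ^+ i *m N ^+ j = N ^+ j *m (N + s) ^+ i.
Proof.
have c : GRing.comm (N + s) N.
  by rewrite /GRing.comm -!mulmxE mulmxDl mulmxDr (nilpair_comm NP).
by apply: commrX; apply: commr_sym; apply: commrX; apply: commr_sym.
Qed.

Lemma isotropic_N (x : 'rV_n) i j : (forall l, Q l x = 0) ->
  f (x *m N ^+ i) (x *m N ^+ j) = 0.
Proof.
move=> Qx; rewrite -bform_adjT -mulmxA (isotropic_word char2 NP Qx) //.
by exists i, j.
Qed.

Lemma isotropic_T (x : 'rV_n) i j : (forall l, Q l x = 0) ->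
  f (x *m (N + s) ^+ i) (x *m (N + s) ^+ j) = 0.
Proof.
move=> Qx; have adjN k u v : f (u *m N ^+ k) v = f u (v *m (N + s) ^+ k).
  elim: k u v => [|k IH] u v; first by rewrite !expmx0 !mulmx1.
  by rewrite expmxSr mulmxA (nilpair_adjN NP) IH -mulmxA -expmxS.
rewrite -adjN -mulmxA comm_word (isotropic_word char2 NP Qx) //.
by exists j, i.
Qed.

Lemma bform_neq0 (L : 'M[F]_n) : A \in unitmx -> L != 0 ->
  exists x y, f (x *m L) y != 0.
Proof.
move=> Au L0; have : L *m A *m 1%:M^T != 0.
  by rewrite trmx1 mulmx1 mulmx_free_eq0 // row_free_unit.
case/matrix0Pn => i [j]; rewrite gramE rowE => ij.
by exists (delta_mx 0 i), (row j 1%:M).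
Qed.

(** First [x] is corrected by [y], then [y] by the new [x]; symmetry of the polar form exchanges the
    roles. *)
Lemma hyperbolic_even m : A \in unitmx -> N ^+ m.+1.*2 = 0 -> N ^+ m.*2.+1 != 0 ->
  exists x y : 'rV_n, [/\ f (x *m N ^+ m.*2.+1) y != 0,
    forall i, Q i x = 0 & forall i, Q i y = 0].
Proof.
move=> Au N0 N1.
have xN (x : 'rV_n) : x *m N ^+ m.*2.+1 = x *m s ^+ m *m N.
  rewrite expmxS -addnn mulmxA (mul_exp_s_id NP Nu).
    by rewrite -mulmxA (comm_exp_s NP) mulmxA.
  by rewrite -mulmxA -expmxS addnn -doubleS N0 mulmx0.
have [x [y xy]] := bform_neq0 Au N1; rewrite xN in xy.
have [x' [xy' Qx']] := isotropic_even N0 xy.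
rewrite -{}xy' polar_sym in xy.
have [y' [xy' Qy']] := isotropic_even N0 xy.
by exists x', y'; split; rewrite // xN polar_sym xy'.
Qed.

Lemma hyperbolic_odd m : A \in unitmx -> N ^+ m.*2.+1 = 0 -> N ^+ m.*2 != 0 ->
  (forall z, Q m z = 0) ->
  exists x y : 'rV_n, [/\ f (x *m N ^+ m.*2) y != 0,
    forall i, Q i x = 0 & forall i, Q i y = 0].
Proof.
move=> Au N0 N1 Qm.
have xN (x : 'rV_n) : x *m N ^+ m.*2 = x *m s ^+ m.
  by rewrite -addnn (mul_exp_s_id NP Nu) // addnn N0 mulmx0.
have top_sym (x y : 'rV_n) : f (y *m s ^+ m) x = f (x *m s ^+ m) y.
  rewrite (bform_s NP) (nilpair_swap NP) (exp_sN_leq0 N0) ?bform0l ?add0r //.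
  by rewrite addnn.
have [x [y xy]] := bform_neq0 Au N1; rewrite xN in xy.
have [x' [xy' Qx']] := isotropic_odd N0 Qm xy.
rewrite -{}xy' top_sym in xy.
have [y' [xy' Qy']] := isotropic_odd N0 Qm xy.
by exists x', y'; split; rewrite // xN top_sym xy'.
Qed.

Lemma top_additive m : N ^+ m.*2.+1 = 0 -> {morph Q m : x y / x + y}.
Proof.
move=> N0 x y; rewrite (qformD char2 NP) (exp_sN_leq0 N0) ?bform0l ?addr0 //.
by rewrite addnn.
Qed.

(** [Q m] is additive and scales by squares, so its vanishing can be tested on a basis. *)
Lemma top_zero m : N ^+ m.*2.+1 = 0 -> (forall i, Q m (delta_mx 0 i) = 0) ->
  forall z, Q m z = 0.
Proof.
move=> N0 Q0 z; rewrite [z]row_sum_delta (big_morph (Q m) (top_additive N0) (id1 := 0)).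
  by rewrite big1 // => i _; rewrite qformZ Q0 mulr0.
by rewrite /qform bform0r.
Qed.

End Vectors.

Section Split.
Variables (n : nat) (A : 'M[F]_n).
Hypothesis Au : A \in unitmx.

Lemma shiftV_exp_eq0 lam k : shift A lam ^+ k = 0 -> shiftV A lam ^+ k = 0.
Proof.
move=> N0; apply: trmx_inj; apply: (can_inj (mulKmx Au)).
by rewrite -exp_shift_adjoint // N0 mul0mx trmx0 mulmx0.
Qed.

Lemma shift1_unit : shift A 1 + 1%:M \in unitmx.
Proof.
by rewrite subrK unitmx_mul unitmx_tr Au unitmx_inv.
Qed.

Lemma nilpotent_index : (0 < n)%N -> shift A 1 ^+ n = 0 ->
  exists k, shift A 1 ^+ k.+1 = 0 /\ shift A 1 ^+ k != 0.
Proof.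
move=> n0 Nn; have ex : exists k, shift A 1 ^+ k == 0 by exists n; rewrite Nn.
case: (ex_minnP ex) => -[|k] /eqP Nk kmin.
  move: Nk; rewrite expmx0 => /(congr1 (@mxrank F n n)); rewrite mxrank1 mxrank0.
  by move=> e; rewrite e in n0.
by exists k; split=> //; apply/negP => /kmin; rewrite ltnn.
Qed.

Lemma split_isotropic s k (x y : 'rV_n) : nilpair A (shift A 1) s ->
  shiftV A 1 = shift A 1 + s -> shift A 1 ^+ k = 0 ->
  bform A (x *m shift A 1 ^+ k.-1) y != 0 ->
  (forall i, qform A s i x = 0) -> (forall i, qform A s i y = 0) ->
  exists m (A' : 'M[F]_m), [/\ (k + k + m)%N = n, A' \in unitmx &
    hcong A (dsum2 (pairmx k 1) A')].
Proof.
move=> NP eT Nk xy Qx Qy.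
have xk : x *m shift A 1 ^+ k = 0 by rewrite Nk mulmx0.
have yk : y *m shiftV A 1 ^+ k = 0 by rewrite shiftV_exp_eq0 // mulmx0.
have [||Z ZZ ZM] := pair_gram Au xk yk xy.
- by move=> i j; apply: (isotropic_N NP).
- by move=> i j; rewrite eT; apply: (isotropic_T NP).
have [|m [A' [e A'u h]]] := split_off Au _ ZM.
  by rewrite ZZ pairmx_unit // oner_neq0.
by exists m, A'; rewrite -ZZ.
Qed.

Lemma unipotent_split : (0 < n)%N -> shift A 1 ^+ n = 0 ->
  (exists k m (A' : 'M[F]_m), [/\ (k.+1 + k + m)%N = n, A' \in unitmx &
     hcong A (dsum2 (stdmx F k) A')]) \/
  (exists k m (A' : 'M[F]_m), [/\ (0 < k)%N, (k + k + m)%N = n, A' \in unitmx &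
     hcong A (dsum2 (pairmx k 1) A')]).
Proof.
move=> n0 Nn; have [k [N0 N1]] := nilpotent_index n0 Nn.
have [s [NP eT]] := asym_nilpair char2 Au.
have Nu := shift1_unit.
(* The nilpotency index is [k.+1]. If it is even, a block (ii) splits off; if it is odd, the top
   form [Q m] with [k = m.*2] decides between the two kinds of block. *)
have := odd_double_half k; case ok: (odd k) => /= [|] kE.
  rewrite -kE add1n in N0 N1; rewrite -doubleS in N0; right.
  have [x [y [xy Qx Qy]]] := hyperbolic_even NP Nu Au N0 N1.
  have [|m [A' [e A'u h]]] := split_isotropic NP eT N0 _ Qx Qy; first by rewrite doubleS.
  by exists (k./2).+1.*2, m, A'; split=> //; rewrite doubleS.
rewrite add0n in kE; rewrite -kE in N0 N1; set m := k./2 in N0 N1.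
have [/existsP[i qi]|] := boolP [exists i, qform A s m (delta_mx 0 i) != 0].
  left; have [|x Qx] := sq_normalize char2 NP (m := m) _ qi.
    by move=> j x mj; rewrite /qform (exp_s_leq0 NP Nu N0) ?bform0l //; lia.
  have [|Z ZZ ZM] := sq_gram char2 NP Qx.
    by rewrite (exp_sN_leq0 NP Nu N0) //; lia.
  have [||m' [A' [e A'u h]]] := split_off Au (Z := Z).
  - by rewrite ZZ stdmx_unit.
  - by move: ZM; rewrite subrK.
  by exists m, m', A'; rewrite -ZZ.
rewrite negb_exists => /forallP qi; right.
have Q0 : forall z, qform A s m z = 0.
  apply: (top_zero NP Nu N0) => i; apply/eqP; rewrite -[_ == _]negbK; exact: qi.
have [x [y [xy Qx Qy]]] := hyperbolic_odd NP Nu Au N0 N1 Q0.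
have [|m' [A' [e A'u h]]] := split_isotropic NP eT N0 _ Qx Qy; first by [].
by exists m.*2.+1, m', A'; split.
Qed.

End Split.
End UnipotentSplit.

(** * Ranks of powers of the cosquare *)

Section JordanRank.
Variable F : fieldType.

Lemma trmx_exp n (X : 'M[F]_n) i : (X ^+ i)^T = X^T ^+ i.
Proof.
elim: i => [|i IH]; first by rewrite !expmx0 trmx1.
by rewrite expmxS trmx_mul IH -expmxSr.
Qed.

Lemma rank_trmx_exp n (X : 'M[F]_n) i : \rank (X^T ^+ i) = \rank (X ^+ i).
Proof. by rewrite -trmx_exp mxrank_tr. Qed.

Lemma exp_conj n (P X : 'M[F]_n) i : P \in unitmx ->
  (P *m X *m invmx P) ^+ i = P *m X ^+ i *m invmx P.
Proof.
move=> Pu; elim: i => [|i IH]; first by rewrite !expmx0 mulmx1 mulmxV.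
by rewrite !expmxS IH !mulmxA mulmxKV.
Qed.

Lemma rank_exp_conj n (P X : 'M[F]_n) i : P \in unitmx ->
  \rank ((P *m X *m invmx P) ^+ i) = \rank (X ^+ i).
Proof.
move=> Pu; rewrite exp_conj // mxrankMfree ?row_free_unit ?unitmx_inv //.
by rewrite eqmxMfull // row_full_unit.
Qed.

Lemma sub_jordan n (a b : F) : jordan n a - b%:M = jordan n (a - b).
Proof.
apply/matrixP=> i j; rewrite !mxE val_eqE; case: eqP => _ //=.
by rewrite mulr0n subr0.
Qed.

Lemma exp_jordan0 n i :
  (jordan n 0 : 'M[F]_n) ^+ i = \matrix_(r, c) ((c : nat) == (r + i)%N)%:R.
Proof.
elim: i => [|i IH].
  by rewrite expmx0; apply/matrixP=> r c; rewrite !mxE addn0 eq_sym.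
rewrite expmxS IH; apply/matrixP=> r c; rewrite !mxE.
have [rn|nr] := ltnP r.+1 n.
  rewrite (bigD1 (Ordinal rn)) //= !mxE /= ltn_eqF // eqxx mul1r addSnnS.
  rewrite big1 ?addr0 // => j; rewrite -val_eqE !mxE /= => jr.
  by rewrite (negPf jr); case: ifP; rewrite mul0r.
rewrite big1 => [|j _].
  by rewrite [in RHS]ltn_eqF //; have := ltn_ord c; lia.
rewrite !mxE; case: ifP => _; first by rewrite mul0r.
by rewrite ltn_eqF ?mul0r //; apply: leq_trans (ltn_ord j) nr.
Qed.

(** Only the first [n - i] rows are nonzero, and they contain an identity submatrix of that size. *)
Lemma rank_exp_jordan0 n i : \rank ((jordan n 0 : 'M[F]_n) ^+ i) = (n - i)%N.
Proof.
rewrite exp_jordan0; set X := \matrix_(r, c) _.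
pose f : 'I_(n - i) -> 'I_n := widen_ord (leq_subr i n).
have ltg (k : 'I_(n - i)) : (k + i < n)%N by have := ltn_ord k; lia.
pose g (k : 'I_(n - i)) := Ordinal (ltg k).
apply/eqP; rewrite eqn_leq; apply/andP; split.
  have -> : X = (rowsub f 1%:M)^T *m rowsub f X.
    apply/matrixP=> r c; rewrite !mxE.
    under eq_bigr do rewrite !mxE -val_eqE /=.
    have [rn|nr] := ltnP r (n - i).
      rewrite (bigD1 (Ordinal rn)) //= eqxx mul1r big1 ?addr0 // => j.
      by rewrite -val_eqE /= => /negPf ->; rewrite mul0r.
    rewrite big1 => [|j _]; first by rewrite ltn_eqF //; have := ltn_ord c; lia.
    by rewrite ltn_eqF ?mul0r //; apply: leq_trans (ltn_ord j) nr.
  exact: leq_trans (mxrankM_maxl _ _) (rank_leq_col _).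
have : mxsub f g X = 1%:M.
  by apply/matrixP=> r c; rewrite !mxE /= eqn_add2r eq_sym.
rewrite -mul_rowsub1 => /(congr1 (@mxrank F _ _)); rewrite mxrank1 => {1}<-.
by apply: leq_trans (mxrankM_maxl _ _) _; apply: mxrankM_maxr.
Qed.

Lemma rank_exp_jordan n (a : F) i :
  \rank (jordan n a ^+ i) = (n - (a == 0%R) * i)%N.
Proof.
have [->|a0] := eqVneq a 0; first by rewrite mul1n rank_exp_jordan0.
rewrite mul0n subn0; apply/eqP; change (row_free (jordan n a ^+ i)).
by rewrite row_free_unit expmx_unit // jordan_unit.
Qed.

End JordanRank.

(** * Rank invariants of the cosquare *)

Section CosquareRank.
Variable F : fieldType.

Definition cosq_rank n (A : 'M[F]_n) lam i := \rank (shift A lam ^+ i).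

(** Congruent forms have similar asymmetries, which makes [cosq_rank] an invariant. *)
Lemma shift_cong n (A X : 'M[F]_n) lam : A \in unitmx -> X \in unitmx ->
  shift (X *m A *m X^T) lam = X *m shift A lam *m invmx X.
Proof.
move=> Au Xu; rewrite mulmxBr mulmxBl mul_mx_scalar -scalemxAl mulmxV // scalemx1.
congr (_ - _); rewrite /asym !trmx_mul trmxK.
have XT : X^T \in unitmx by rewrite unitmx_tr.
apply: (can_inj (mulmxK Xu)); rewrite mulmxKV //.
apply: (can_inj (mulmxK Au)); apply: (can_inj (mulmxK XT)).
rewrite -(mulmxA _ X A) -(mulmxA _ (X *m A)) mulmxKV; last first.
  by rewrite !unitmx_mul Xu Au.
by rewrite -(mulmxA X _ A) mulmxKV // mulmxA.
Qed.

Lemma cosq_rank_hcong m n (A : 'M[F]_m) (B : 'M[F]_n) lam i :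
  A \in unitmx -> hcong A B -> cosq_rank A lam i = cosq_rank B lam i.
Proof.
move=> Au [e]; subst n; case=> X; rewrite row_free_unit => Xu <-.
by rewrite /cosq_rank shift_cong // rank_exp_conj.
Qed.

Lemma dsum2_exp m n (A : 'M[F]_m) (B : 'M[F]_n) i :
  dsum2 A B ^+ i = dsum2 (A ^+ i) (B ^+ i).
Proof.
elim: i => [|i IH]; first by rewrite !expmx0 [LHS]scalar_mx_block.
by rewrite !expmxS IH mul_dsum2.
Qed.

Lemma dsum2_sub m n (A A' : 'M[F]_m) (B B' : 'M[F]_n) :
  dsum2 A B - dsum2 A' B' = dsum2 (A - A') (B - B').
Proof. by rewrite /dsum2 opp_block_mx add_block_mx !oppr0 !addr0. Qed.

Lemma asym_dsum2 m n (A : 'M[F]_m) (B : 'M[F]_n) :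
  A \in unitmx -> B \in unitmx -> asym (dsum2 A B) = dsum2 (asym A) (asym B).
Proof. by move=> Au Bu; rewrite /asym tr_dsum2 inv_dsum2 // mul_dsum2. Qed.

Lemma asymV_dsum2 m n (A : 'M[F]_m) (B : 'M[F]_n) :
  A \in unitmx -> B \in unitmx -> asymV (dsum2 A B) = dsum2 (asymV A) (asymV B).
Proof.
by move=> Au Bu; rewrite /asymV tr_dsum2 inv_dsum2 ?unitmx_tr // mul_dsum2.
Qed.

Lemma shift_dsum2 m n (A : 'M[F]_m) (B : 'M[F]_n) lam :
  A \in unitmx -> B \in unitmx ->
  shift (dsum2 A B) lam = dsum2 (shift A lam) (shift B lam).
Proof.
by move=> Au Bu; rewrite /shift asym_dsum2 // [lam%:M]scalar_mx_block dsum2_sub.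
Qed.

Lemma shiftV_dsum2 m n (A : 'M[F]_m) (B : 'M[F]_n) lam :
  A \in unitmx -> B \in unitmx ->
  shiftV (dsum2 A B) lam = dsum2 (shiftV A lam) (shiftV B lam).
Proof.
by move=> Au Bu; rewrite /shiftV asymV_dsum2 // [lam%:M]scalar_mx_block dsum2_sub.
Qed.

Lemma cosq_rank_dsum2 m n (A : 'M[F]_m) (B : 'M[F]_n) lam i :
  A \in unitmx -> B \in unitmx ->
  cosq_rank (dsum2 A B) lam i = (cosq_rank A lam i + cosq_rank B lam i)%N.
Proof. by move=> Au Bu; rewrite /cosq_rank shift_dsum2 // dsum2_exp rank_diag_block_mx. Qed.

Lemma asym_pairmx k (mu : F) : mu != 0 ->
  asym (pairmx k mu) = dsum2 (jordan k mu)^T (invmx (jordan k mu)).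
Proof.
move=> mu0; have Ju := jordan_unit k mu0; have Pu := pairmx_unit k mu0.
apply: (can_inj (mulmxK Pu)); rewrite asym_mul // /pairmx tr_block_mx mulmx_block.
by rewrite !(trmx0, trmx1, mulmx0, mul0mx, mulmx1, mulVmx, addr0, add0r).
Qed.

Lemma cosq_rank_pairmx k (mu lam : F) i : mu != 0 -> lam != 0 ->
  cosq_rank (pairmx k mu) lam i =
  ((k - (mu == lam) * i) + (k - (mu == (lam^-1)%R) * i))%N.
Proof.
move=> mu0 lam0; rewrite /cosq_rank /shift asym_pairmx // [lam%:M]scalar_mx_block.
rewrite dsum2_sub dsum2_exp rank_diag_block_mx; congr (_ + _)%N.
  rewrite -tr_scalar_mx -linearB rank_trmx_exp /= sub_jordan rank_exp_jordan.
  by rewrite subr_eq0.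
have Ju := jordan_unit k mu0.
(* The inverse block shifted by [lam] is a unit times [jordan k mu] shifted by [lam^-1]; the two
   factors commute, so the power distributes. *)
have -> : invmx (jordan k mu) - lam%:M =
    - (lam *: invmx (jordan k mu)) *m (jordan k (mu - lam^-1)).
  rewrite -sub_jordan mulmxBr !mulNmx -scalemxAl mulVmx // scalemx1 mul_mx_scalar.
  by rewrite opprK scalerA mulVf // scale1r addrC.
rewrite -[mu == _]subr_eq0 -rank_exp_jordan mulmxE exprMn_comm; last first.
  rewrite /GRing.comm -!mulmxE -sub_jordan mulmxBl mulmxBr !mulmxN !mulNmx.
  by rewrite -scalemxAl -scalemxAr mulVmx // mulmxV // scalar_mxC.
rewrite -mulmxE eqmxMfull // row_full_unit expmx_unit //.
by rewrite -scaleN1r scalerA unitmxZ ?unitmx_inv // unitfE mulN1r oppr_eq0.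
Qed.

Lemma cosq_rank_sqrtT n (A : 'M[F]_n) lam i :
  sqrtT_like A -> cosq_rank A lam i = (n - (1%R == lam) * i)%N.
Proof.
case=> Au [P [Pu PJ]]; rewrite /cosq_rank /shift.
have -> : asym A = (cosquare A)^T by rewrite -trmx_asym trmxK.
have -> : cosquare A = P *m jordan n 1 *m invmx P.
  by rewrite -PJ !mulmxA mulmxV // mul1mx mulmxK.
have -> : (P *m jordan n 1 *m invmx P)^T - lam%:M =
    (P *m (jordan n 1 - lam%:M) *m invmx P)^T.
  rewrite mulmxBr mulmxBl mul_mx_scalar -scalemxAl mulmxV // scalemx1 linearB /=.
  by rewrite tr_scalar_mx.
by rewrite rank_trmx_exp rank_exp_conj // sub_jordan rank_exp_jordan subr_eq0.
Qed.

End CosquareRank.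

(** * Blocks (iii) up to congruence, and the relation between three of them *)

Section SquareBlocks.
Variable F : closedFieldType.
Hypothesis char2 : (2 \in [pchar F])%N.

(* A symmetric form of rank one is not alternating. *)
Lemma top_rank1 n (A : 'M[F]_n) s m : A \in unitmx -> nilpair A (shift A 1) s ->
  shift A 1 ^+ m.*2.+1 = 0 -> \rank (shift A 1 ^+ m.*2) = 1%N ->
  exists x, qform A s m x != 0.
Proof.
move=> Au NP N0 rk; have Nu := shift1_unit Au.
set N := shift A 1 in NP N0 rk Nu.
have xN (x : 'rV_n) : x *m N ^+ m.*2 = x *m s ^+ m.
  by rewrite -addnn (mul_exp_s_id NP Nu) // addnn N0 mulmx0.
have top_sym (x y : 'rV_n) : bform A (y *m s ^+ m) x = bform A (x *m s ^+ m) y.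
  rewrite (bform_s NP) (nilpair_swap NP) (exp_sN_leq0 NP Nu N0) ?bform0l ?add0r //.
  by rewrite addnn.
have [x [y xy]] : exists x y, bform A (x *m N ^+ m.*2) y != 0.
  by apply: bform_neq0 => //; rewrite -mxrank_eq0 rk.
have [qy|qy] := eqVneq (qform A s m y) 0; last by exists y.
have x0 : x *m N ^+ m.*2 != 0.
  by apply: contraNneq xy => ->; rewrite bform0l.
(* Rank one makes the images of [x] and [y] proportional. If the form vanished at [y], the factor
   [c] would be zero, against the symmetry of the form. *)
have /sub_rVP[c yx] : (y *m N ^+ m.*2 <= x *m N ^+ m.*2)%MS.
  have := mxrank_leqif_eq (submxMl x (N ^+ m.*2)); rewrite rk rank_rV x0 => -[_].
  by rewrite eqxx => /esym/eqmxP ->; apply: submxMl.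
rewrite !xN in xy yx; have := qy; rewrite /qform yx bformZl => /eqP.
rewrite mulf_eq0 (negPf xy) orbF => /eqP c0.
by move: xy; rewrite -top_sym yx c0 scale0r bform0l eqxx.
Qed.

(** The ranks describe a single Jordan block of odd size; a normalised vector then generates the
    whole space, with Gram matrix [stdmx F m]. *)
Lemma std_of_rank n (A : 'M[F]_n) m : A \in unitmx -> n = m.*2.+1 ->
  shift A 1 ^+ n = 0 -> \rank (shift A 1 ^+ n.-1) = 1%N -> hcong A (stdmx F m).
Proof.
move=> Au en Nn rkn; have N0 : shift A 1 ^+ m.*2.+1 = 0 by rewrite -en.
have rk : \rank (shift A 1 ^+ m.*2) = 1%N by rewrite -[m.*2]/(m.*2.+1.-1) -en.
have [s [NP eT]] := asym_nilpair char2 Au; have Nu := shift1_unit Au.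
have [x0 qx0] := top_rank1 Au NP N0 rk.
have [|x Qx] := sq_normalize char2 NP (m := m) _ qx0.
  by move=> j x mj; rewrite /qform (exp_s_leq0 NP Nu N0) ?bform0l //; lia.
have [|Z ZZ _] := sq_gram char2 NP Qx.
  by rewrite (exp_sN_leq0 NP Nu N0) //; lia.
split; first by rewrite en -addnn addSn.
exists Z => //; apply: inj_row_free => v vZ.
apply: (can_inj (mulmxK (stdmx_unit F m))).
by rewrite -ZZ !mulmxA vZ !mul0mx.
Qed.

Lemma sqrtT_std n (A : 'M[F]_n) : odd n -> sqrtT_like A -> hcong A (stdmx F n./2).
Proof.
move=> on sA; have Au : A \in unitmx by case: sA.
apply: std_of_rank => //; first by have := odd_double_half n; rewrite on.
  apply/eqP; rewrite -mxrank_eq0 -/(cosq_rank A 1 n) cosq_rank_sqrtT // eqxx.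
  by rewrite mul1n subnn.
rewrite -/(cosq_rank A 1 n.-1) cosq_rank_sqrtT // eqxx mul1n.
by case: n on {A sA Au} => // n _; rewrite /= subSnn.
Qed.

Lemma sqrtT_congruent n (A B : 'M[F]_n) : odd n ->
  sqrtT_like A -> sqrtT_like B -> congruent A B.
Proof.
move=> on /(sqrtT_std on) hA /(sqrtT_std on) hB; apply/hcongP.
exact: hcong_trans hA (hcong_sym hB).
Qed.

Lemma bform_dsum2 m n (A : 'M[F]_m) (B : 'M[F]_n) x y x' y' :
  bform (dsum2 A B) (row_mx x y) (row_mx x' y') = bform A x x' + bform B y y'.
Proof.
rewrite /bform /dsum2 mul_row_block !mulmx0 addr0 add0r tr_row_mx mul_row_col.
by rewrite mxE.
Qed.

Lemma mul_row_dsum2 m n (A : 'M[F]_m) (B : 'M[F]_n) p (x : 'M_(p, m)) (y : 'M_(p, n)) :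
  row_mx x y *m dsum2 A B = row_mx (x *m A) (y *m B).
Proof. by rewrite /dsum2 mul_row_block !mulmx0 addr0 add0r. Qed.

(* For [a], [b], [c] the images of a cyclic vector in the three summands,
   [a + c] and [b + c] span the summand [pairmx n 1]. *)
Lemma three_sqrtT n (S0 : 'M[F]_n) : odd n -> sqrtT_like S0 ->
  hcong (dsum2 S0 (dsum2 S0 S0)) (dsum2 S0 (pairmx n 1)).
Proof.
move=> on sS; have Su : S0 \in unitmx by case: sS.
have nE : n = (n./2).*2.+1 by have := odd_double_half n; rewrite on.
have rS i : cosq_rank S0 1 i = (n - i)%N by rewrite cosq_rank_sqrtT // eqxx mul1n.
set A := dsum2 S0 (dsum2 S0 S0); have Au : A \in unitmx by rewrite !dsum2_unit Su.
have [s0 [NP0 eT0]] := asym_nilpair char2 Su.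
have [s [NP eT]] := asym_nilpair char2 Au.
have ns : s = dsum2 s0 (dsum2 s0 s0).
  have -> : s = shiftV A 1 - shift A 1 by rewrite eT addrAC subrr add0r.
  have -> : s0 = shiftV S0 1 - shift S0 1 by rewrite eT0 addrAC subrr add0r.
  by rewrite /A !shiftV_dsum2 ?dsum2_unit ?Su // !shift_dsum2 ?dsum2_unit ?Su // !dsum2_sub.
have N0 : shift S0 1 ^+ n = 0.
  by apply/eqP; rewrite -mxrank_eq0; move: (rS n); rewrite /cosq_rank => ->; rewrite subnn.
have NA0 : shift A 1 ^+ n = 0.
  rewrite !shift_dsum2 ?dsum2_unit ?Su // !dsum2_exp N0.
  by rewrite /dsum2 -[block_mx 0 0 0 0]/(block_mx 0 0 0 0) !block_mx_const.
have [x qx] : exists x, qform S0 s0 n./2 x != 0.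
  apply: top_rank1 => //; first by rewrite -nE.
  have -> : (n./2).*2 = n.-1 by lia.
  by move: (rS n.-1); rewrite /cosq_rank => ->; lia.
pose u : 'rV_(n + (n + n)) := row_mx 0 (row_mx x x).
pose v : 'rV_(n + (n + n)) := row_mx x (row_mx 0 x).
(* The same value arises from two summands and cancels in characteristic two. *)
have Qu i : qform A s i u = 0.
  rewrite /qform ns !dsum2_exp /u !mul_row_dsum2 !bform_dsum2 !mul0mx !bform0l.
  by rewrite add0r (addff2 char2).
have Qv i : qform A s i v = 0.
  rewrite /qform ns !dsum2_exp /v !mul_row_dsum2 !bform_dsum2 !mul0mx !bform0l.
  by rewrite add0r (addff2 char2).
(* Only the last summand contributes, with the nonzero value [qform S0 s0 n./2 x]. *)
have uv : bform A (u *m shift A 1 ^+ n.-1) v != 0.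
  rewrite !shift_dsum2 ?dsum2_unit ?Su // !dsum2_exp /u /v !mul_row_dsum2.
  rewrite !bform_dsum2 !mul0mx !bform0l bform0r !add0r.
  have -> : n.-1 = (n./2 + n./2)%N by lia.
  rewrite (mul_exp_s_id NP0 (shift1_unit Su)) //.
  by rewrite addnn -nE N0 mulmx0.
have [m [A' [em A'u h]]] := split_isotropic char2 Au NP eT NA0 uv Qu Qv.
have {}em : m = n by lia.
subst m; have Pu : pairmx n (1 : F) \in unitmx by rewrite pairmx_unit ?oner_neq0.
(* Cancelling the contribution of [pairmx n 1] shows that the complement has the ranks of one Jordan
   block, so it is again a block (iii). *)
have rA' i : cosq_rank A' 1 i = (n - i)%N.
  have := cosq_rank_hcong 1 i Au h; rewrite !cosq_rank_dsum2 ?dsum2_unit ?Su //.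
  rewrite cosq_rank_pairmx ?oner_neq0 // invr1 eqxx mul1n !rS; lia.
apply: hcong_trans h _; apply: hcong_trans (hcong_dsum2C _ _) _.
apply: hcong_dsum2 (hcong_refl _).
apply: hcong_trans (hcong_sym (sqrtT_std on sS)).
apply: std_of_rank => //.
  by apply/eqP; rewrite -mxrank_eq0 -/(cosq_rank A' 1 n) rA' subnn.
by rewrite -/(cosq_rank A' 1 n.-1) rA'; lia.
Qed.

End SquareBlocks.

(** * Existence *)

Section Existence.
Variable F : closedFieldType.
Hypothesis char2 : (2 \in [pchar F])%N.
Variable S : forall n, 'M[F]_n.
Hypothesis S_sqrtT : forall n, odd n -> sqrtT_like (S n).

Lemma asym_eigenvalue n (A : 'M[F]_n) : A \in unitmx -> (0 < n)%N ->
  (exists lam, [/\ lam != 0, lam ^+ 2 != 1 & eigenvalue (asym A) lam]) \/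
  shift A 1 ^+ n = 0.
Proof.
move=> Au; case: n A Au => // n A Au _.
have [r re] := closed_field_poly_normal (char_poly (asym A)).
rewrite (eqP (char_poly_monic _)) scale1r in re.
(* If all characteristic roots are 1, Cayley-Hamilton gives unipotency. Otherwise a root other than
   1 has square other than 1, since -1 is 1. *)
have [r1|/allPn[z zr /= z1]] := boolP (all (pred1 1) r); [right|left; exists z].
  have := Cayley_Hamilton (asym A); rewrite re.
  have -> : \prod_(z <- r) ('X - z%:P) = ('X - 1%:P) ^+ size r.
    elim: r r1 {re} => [_|z r IH /andP[/eqP -> /IH e]]; first by rewrite big_nil.
    by rewrite big_cons e exprS.
  have -> : size r = n.+1.
    by apply: succn_inj; rewrite -(size_char_poly (asym A)) re size_prod_XsubC.
  by rewrite rmorphXn rmorphB /= horner_mx_X horner_mx_C.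

have ev : eigenvalue (asym A) z.
  by rewrite eigenvalue_root_char re root_prod_XsubC.
split=> //.
  apply: contraTneq ev => ->; rewrite /eigenvalue negbK /eigenspace kermx_eq0.
  by rewrite raddf0 subr0 row_free_unit unitmx_mul unitmx_tr Au unitmx_inv Au.
by rewrite sqrf_eq1 negb_or z1 [- 1](oppv2 char2 (1 : F^o)) z1.
Qed.

Lemma nonsingular_blocks n (A : 'M[F]_n) : A \in unitmx ->
  exists2 l, (forall b, List.In b l -> is_reg b /\ blk_ok b) & hcong A (dsum S l).
Proof.
elim/ltn_ind: n A => -[|n] IH A Au.
  by exists [::] => //; rewrite [A]flatmx0; apply: hcong_refl.
have cons b m (A' : 'M[F]_m) : is_reg b -> blk_ok b -> (m < n.+1)%N -> A' \in unitmx ->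
    hcong A (dsum2 (bmx S b) A') ->
    exists2 l, (forall b, List.In b l -> is_reg b /\ blk_ok b) & hcong A (dsum S l).
  move=> breg bok mn A'u h; have [l lok h'] := IH m mn A' A'u.
  exists (b :: l); first by move=> c [<- //|]; apply: lok.
  by apply: hcong_trans h _; apply: hcong_dsum2 (hcong_refl _) h'.
have [[lam [lam0 lam1 ev]]|N0] := asym_eigenvalue Au (ltn0Sn n).
  have [k [m [A' [k0 em A'u h]]]] := split_pair Au lam0 lam1 ev.
  by apply: (cons (BPair k lam) m A') => //; lia.
have [[k [m [A' [em A'u h]]]]|] := unipotent_split char2 Au (ltn0Sn n) N0.
  have ok : odd (k.+1 + k) by rewrite addSn addnn /= odd_double.
  apply: (cons (BSq F (k.+1 + k)) m A') => //; first by lia.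
  apply: hcong_trans h _; apply: hcong_dsum2 (hcong_refl _); apply: hcong_sym.
  have := sqrtT_std char2 ok (S_sqrtT ok).
  have -> // : ((k.+1 + k)./2 = k)%N; lia.
case=> k [m [A' [k0 em A'u h]]].
apply: (cons (BPair k 1) m A') => //; last by lia.
by split=> //; apply: oner_neq0.
Qed.

Definition conflict (l : seq (blk F)) : pred (blk F) := fun b =>
  if b is BSq n then
    odd n && has (fun c => if c is BPair m a then (m == n) && (a == 1) else false) l
  else false.

(** Induction on the number of blocks (ii): [three_sqrtT] trades a forbidden one for two more blocks
    (iii), which lowers this number. *)
Lemma admissible_blocks l : (forall b, List.In b l -> is_reg b /\ blk_ok b) ->
  exists l', [/\ forall b, List.In b l' -> is_reg b, admissible l' &
    hcong (dsum S l) (dsum S l')].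
Proof.
have [N] := ubnP (count (@is_pair F) l); elim: N l => // N IH l lN lok.
have [|/negP nc] := boolP (has (conflict l) l); last first.
  exists l; split; [by move=> b /lok[]| |exact: hcong_refl].
  split; first by move=> b /lok[].
  move=> n on sl pl; apply: nc; apply/has_In; exists (BSq F n) => //=.
  rewrite on /=; apply/has_In; exists (BPair n 1) => //; rewrite !eqxx //.
case/has_In => -[//|//|n] sl /= /andP[on /has_In[[//|m a|//] pl /andP[/eqP em /eqP ea]]].
subst m a; have [l1 p1] := In_perm sl.
have pl1 : List.In (BPair n 1) l1 by have [] := Permutation.Permutation_in _ p1 pl.
have [l2 p2] := In_perm pl1.
have p : Permutation.Permutation l [:: BSq F n, BPair n 1 & l2].
  exact: Permutation.perm_trans p1 (Permutation.perm_skip _ p2).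
have cE : count (@is_pair F) l = (count (@is_pair F) l2).+1.
  by rewrite -[RHS]/(count (@is_pair F) [:: BSq F n, BPair n 1 & l2]); elim: p => //=; lia.
have lok2 b : List.In b l2 -> is_reg b /\ blk_ok b.
  move=> bl; apply: lok.
  by apply: Permutation.Permutation_in (Permutation.Permutation_sym p) _; right; right.
have [||l' [reg adm h]] := IH [:: BSq F n, BSq F n, BSq F n & l2].
- by rewrite /= !add0n; lia.
- by move=> b /= [<-|[<-|[<-|/lok2 //]]]; split=> //; apply: (lok _ sl).2.
exists l'; split=> //; apply: hcong_trans (dsum_perm S p) _; apply: hcong_trans h.
rewrite /=.
apply: hcong_trans (hcong_dsum2A _ _ _) _.
have h3 := three_sqrtT char2 on (S_sqrtT on).
apply: hcong_trans (hcong_dsum2 (hcong_sym h3) (hcong_refl _)) _.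
apply: hcong_trans (hcong_sym (hcong_dsum2A _ _ _)) _.
apply: hcong_dsum2 (hcong_refl _) _.
exact: hcong_sym (hcong_dsum2A _ _ _).
Qed.

Lemma admissible_exists n (A : 'M[F]_n) :
  exists2 l, admissible l & hcong (dsum S l) A.
Proof.
have [s [c [C [s1 Cu AC]]]] := regularization_exists S A.
have [l0 l0ok CL] := nonsingular_blocks Cu.
have [l [lreg ladm LL]] := admissible_blocks l0ok.
exists ([seq BJ0 F n | n <- s] ++ l); last first.
  apply: hcong_sym; apply: hcong_trans AC _; apply: hcong_sym.
  apply: hcong_trans (dsum_cat S _ _) _; apply: hcong_dsum2 (hcong_refl _) _.
  by apply: hcong_sym; apply: hcong_trans CL LL.
have Js b : List.In b [seq BJ0 F n | n <- s] -> exists2 m, b = BJ0 F m & (0 < m)%N.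
  elim: (s) s1 => //= m t IHt /andP[m0 /IHt h] [<-|/h //]; by exists m.
case: ladm => lok lsep; split=> [b|m om].
  by move/(List.in_app_or _ _ _) => [/Js[m -> m0]|/lok].
move/(List.in_app_or _ _ _) => [/Js[? //]|sl].
by move/(List.in_app_or _ _ _) => [/Js[? //]|]; apply: lsep.
Qed.

End Existence.

(** * Uniqueness of the nonsingular part *)

Section OddInvariant.
Variable F : closedFieldType.
Hypothesis char2 : (2 \in [pchar F])%N.

(** The vanishing of the top quadratic form on the kernel, written without [s]: there [s ^+ m]
    agrees with the power [m.*2] of the shift. *)
Definition alternating_at m n (A : 'M[F]_n) := forall x : 'rV_n,
  x *m shift A 1 ^+ m.*2.+1 = 0 -> bform A (x *m shift A 1 ^+ m.*2) x = 0.

Lemma alternating_at_hcong m n n' (A : 'M[F]_n) (B : 'M[F]_n') :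
  A \in unitmx -> hcong A B -> alternating_at m A -> alternating_at m B.
Proof.
move=> Au [e]; subst n'; case=> X; rewrite row_free_unit => Xu <- altA y.
rewrite shift_cong // !exp_conj // !mulmxA => yX.
have {}yX : y *m X *m shift A 1 ^+ m.*2.+1 = 0.
  have iXu : invmx X \in unitmx by rewrite unitmx_inv.
  by apply: (can_inj (mulmxK iXu)); rewrite yX mul0mx.
have := altA _ yX; rewrite /bform trmx_mul !mulmxA mulmxKV //.
Qed.

Lemma alternating_at_dsum2 m n n' (A : 'M[F]_n) (B : 'M[F]_n') :
  A \in unitmx -> B \in unitmx ->
  alternating_at m (dsum2 A B) <-> alternating_at m A /\ alternating_at m B.
Proof.
move=> Au Bu; split=> [alt | [altA altB] x].
  split=> x xN; [have := alt (row_mx x 0) | have := alt (row_mx 0 x)];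
    rewrite !shift_dsum2 // !dsum2_exp !mul_row_dsum2 xN !mul0mx row_mx0 => /(_ erefl);
    by rewrite bform_dsum2 bform0r ?addr0 ?add0r.
rewrite -[x]hsubmxK !shift_dsum2 // !dsum2_exp !mul_row_dsum2 bform_dsum2 => e.
have [eA eB] : lsubmx x *m shift A 1 ^+ m.*2.+1 = 0 /\ rsubmx x *m shift B 1 ^+ m.*2.+1 = 0.
  by apply: eq_row_mx; rewrite row_mx0.
by rewrite altA ?altB ?addr0.
Qed.

Lemma shiftV_kernel n (A : 'M[F]_n) (x : 'rV_n) a : A \in unitmx ->
  x *m shift A 1 ^+ a = 0 -> x *m shiftV A 1 ^+ a = 0.
Proof.
move=> Au xN; have -> : shiftV A 1 = shift A 1 *m - asymV A.
  by rewrite mulmxN mulmxBl asymK // mul1mx opprB.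
rewrite mulmxE exprMn_comm.
  by rewrite -mulmxE mulmxA xN mul0mx.
rewrite /GRing.comm -!mulmxE mulmxN mulNmx mulmxBl mulmxBr asymK // asymVK //.
by rewrite mul1mx mulmx1.
Qed.

(** Both halves of the space are totally isotropic and stable under the asymmetry; the two cross
    terms agree on the kernel and cancel in characteristic two. *)
Lemma alternating_at_pairmx m k mu : mu != 0 -> alternating_at m (pairmx k mu : 'M[F]_(k + k)).
Proof.
move=> mu0 x; set A := pairmx k mu; have Au : A \in unitmx by apply: pairmx_unit.
have [s [NP eT]] := asym_nilpair char2 Au; have Nu := shift1_unit Au.
have halves : shift A 1 = dsum2 ((jordan k mu)^T - 1%:M) (invmx (jordan k mu) - 1%:M).
  by rewrite /shift asym_pairmx // (@scalar_mx_block _ k k 1) dsum2_sub.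
rewrite -[x]hsubmxK; move: (lsubmx x) (rsubmx x) => u v xN.
have [uN vN] : row_mx u 0 *m shift A 1 ^+ m.*2.+1 = 0 /\
               row_mx 0 v *m shift A 1 ^+ m.*2.+1 = 0.
  move: xN; rewrite halves dsum2_exp !mul_row_dsum2 !mul0mx -[0 in RHS]row_mx0.
  by case/eq_row_mx => -> ->; rewrite !row_mx0.
have form a b c d : bform A (row_mx a b) (row_mx c d) =
    (a *m d^T) 0 0 + (b *m jordan k mu *m c^T) 0 0.
  rewrite /bform /A /pairmx mul_row_block !mulmx0 mulmx1 addr0 add0r tr_row_mx.
  by rewrite mul_row_col mxE addrC.
have -> : row_mx u v = row_mx u 0 + row_mx 0 v.
  by rewrite add_row_mx addr0 add0r.
rewrite mulmxDl !(bformDl, bformDr).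
have -> : bform A (row_mx u 0 *m shift A 1 ^+ m.*2) (row_mx u 0) = 0.
  rewrite halves dsum2_exp mul_row_dsum2 form mul0mx trmx0 mulmx0 !mul0mx !mxE.
  exact: addr0.
have -> : bform A (row_mx 0 v *m shift A 1 ^+ m.*2) (row_mx 0 v) = 0.
  by rewrite halves dsum2_exp mul_row_dsum2 form mul0mx trmx0 mulmx0 !mul0mx !mxE addr0.
rewrite add0r addr0; move: (row_mx u 0) (row_mx 0 v) uN vN => X Y XN YN.
rewrite -addnn in XN YN *; rewrite !(mul_exp_s_id NP Nu) //.
have -> : bform A (Y *m s ^+ m) X = bform A (X *m s ^+ m) Y.
  rewrite (bform_s NP) (nilpair_swap NP); have /eqP := XN.
  by rewrite -(mul_exp_sN_eq0 NP Nu) => /eqP ->; rewrite bform0l add0r.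
exact: addff2.
Qed.

Lemma alternating_at_sqrtT m n (A : 'M[F]_n) : odd n -> sqrtT_like A ->
  alternating_at m A <-> n <> m.*2.+1.
Proof.
move=> on sA; have Au : A \in unitmx by case: sA.
have rA i : \rank (shift A 1 ^+ i) = (n - i)%N.
  by have := cosq_rank_sqrtT 1 i sA; rewrite eqxx mul1n.
have Nn i : (n <= i)%N -> shift A 1 ^+ i = 0.
  by move=> ni; apply/eqP; rewrite -mxrank_eq0 rA subn_eq0.
have [s [NP eT]] := asym_nilpair char2 Au.
split=> [alt en | nm x xN].
  have [||x qx] := top_rank1 Au NP (m := m).
  - by apply: Nn; rewrite en.
  - by rewrite rA en subSnn.
  case/eqP: qx; rewrite /qform -(mul_exp_s_id NP (shift1_unit Au)) ?addnn.
    by apply: alt; rewrite Nn ?en ?mulmx0.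
  by rewrite Nn ?en ?mulmx0.
have [mn|nm'] := ltnP m.*2 n; last by rewrite Nn // mulmx0 bform0l.
have {mn nm} mn : (m.*2.+1 < n)%N by lia.
set d := (n - m.*2.+1)%N.
(* For a single Jordan block the kernel of a power is the image of the complementary power. Moving
   all factors to the second argument then exceeds the nilpotency index, as [d > 0]. *)
have /submxP[z ->] : (x <= shift A 1 ^+ d)%MS.
  have le : (shift A 1 ^+ d <= kermx (shift A 1 ^+ m.*2.+1))%MS.
    by rewrite sub_kermx -expmxD Nn // /d; lia.
  have := mxrank_leqif_eq le; rewrite mxrank_ker !rA => -[_].
  rewrite (_ : (n - d == n - (n - m.*2.+1))%N = true); last by rewrite /d eqxx.
  by move/esym/eqmxP => ->; rewrite sub_kermx xN.
rewrite -mulmxA -expmxD bform_shift //.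
rewrite shiftV_kernel ?bform0r //.
by rewrite -mulmxA -expmxD Nn ?mulmx0 // /d; lia.
Qed.

End OddInvariant.

(** * Counting blocks up to equivalence *)

Section BlockCounting.
Variable F : fieldType.
Implicit Types (b c : blk F) (l : seq (blk F)).

Definition blk_eqv b c : bool :=
  match b, c with
  | BJ0 n, BJ0 m => n == m
  | BPair n lam, BPair m mu => (n == m) && ((mu == lam) || (mu == lam^-1))
  | BSq n, BSq m => n == m
  | _, _ => false
  end.

Lemma blk_eqv_equiv b c : blk_eqv b c -> blk_equiv b c.
Proof.
case: b c => [n|n a|n] [m|m d|m] //=; [by move/eqP| |by move/eqP].
by case/andP=> /eqP -> /orP[] /eqP ->; split; auto.
Qed.

Lemma blk_eqv_refl b : blk_eqv b b.
Proof. by case: b => [n|n a|n] /=; rewrite ?eqxx. Qed.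

Lemma blk_eqv_trans b c d : blk_eqv b c -> blk_eqv d b = blk_eqv d c.
Proof.
case: b c d => [n|n a|n] [m|m e|m] [p|p g|p] //=; try by move/eqP->.
case/andP=> /eqP -> /orP[] /eqP -> //.
by rewrite (inj_eq invr_inj) orbC (can2_eq (@invrK _) (@invrK _)).
Qed.

Lemma count_perm l1 l2 (p : pred (blk F)) :
  Permutation.Permutation l1 l2 -> count p l1 = count p l2.
Proof. by elim=> //= *; lia. Qed.

(** Greedy matching: an equivalent partner of the head of [l1] is removed from [l2], and both lists
    then lose the same contribution to every count. *)
Lemma count_blocks_equiv l1 l2 :
  (forall b, List.In b l2 -> blk_ok b) -> (forall b, List.In b l1 -> blk_ok b) ->
  (forall b, blk_ok b -> count (blk_eqv b) l1 = count (blk_eqv b) l2) ->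
  blocks_equiv l1 l2.
Proof.
elim: l1 l2 => [|b l1 IH] l2 ok2 ok1 cnt.
  exists [::]; split; first by constructor.
  case: l2 ok2 cnt => [|c l2] ok2 cnt; first by constructor.
  by have := cnt c (ok2 c (or_introl erefl)); rewrite /= blk_eqv_refl.
have bok : blk_ok b by apply: ok1; left.
have /has_In[c cl bc] : has (blk_eqv b) l2.
  by rewrite has_count -cnt //= blk_eqv_refl.
have [l3 p3] := In_perm cl.
have sub d : List.In d l3 -> List.In d l2.
  by move=> dl; apply: Permutation.Permutation_in (Permutation.Permutation_sym p3) _; right.
have [||d dok|l [h1 h2]] := IH l3.
- by move=> d /sub; apply: ok2.
- by move=> d dl; apply: ok1; right.
- have := cnt d dok; rewrite (count_perm _ p3) /= (blk_eqv_trans d bc).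
  by move/addnI.
exists (c :: l); split; first by constructor => //; apply: blk_eqv_equiv.
apply: Permutation.perm_trans (Permutation.Permutation_sym p3).
exact: Permutation.perm_skip.
Qed.

Definition zero_sizes l := pmap (fun b => if b is BJ0 n then Some n else None) l.

Lemma perm_zero_reg l :
  Permutation.Permutation l ([seq BJ0 F n | n <- zero_sizes l] ++ filter (@is_reg F) l).
Proof.
elim: l => //= b l IH; case: b => [n|n a|n] /=; first exact: Permutation.perm_skip.
all: by apply: Permutation.Permutation_trans (Permutation.Permutation_middle _ _ _);
  apply: Permutation.perm_skip.
Qed.

Lemma count_zero_sizes n l : count (blk_eqv (BJ0 F n)) l = count_mem n (zero_sizes l).
Proof. by elim: l => //= b l ->; case: b => //= m; rewrite eq_sym. Qed.

Lemma count_reg b l : is_reg b ->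
  count (blk_eqv b) l = count (blk_eqv b) (filter (@is_reg F) l).
Proof. by move=> rb; elim: l => //= c l ->; case: c b rb => [m|m d|m] [n|n a|n]. Qed.

End BlockCounting.

(** * Multiplicities of blocks as congruence invariants *)

Section Uniqueness.
Variable F : closedFieldType.
Hypothesis char2 : (2 \in [pchar F])%N.
Variable S : forall n, 'M[F]_n.
Hypothesis S_sqrtT : forall n, odd n -> sqrtT_like (S n).
Implicit Types (b : blk F) (l : seq (blk F)).

Lemma bmx_unit b : is_reg b -> blk_ok b -> bmx S b \in unitmx.
Proof.
case: b => [n|n a|n] //= _ [n0 h]; first exact: pairmx_unit.
by case: (S_sqrtT h).
Qed.

Lemma dsum_unit l : (forall b, List.In b l -> is_reg b /\ blk_ok b) ->
  dsum S l \in unitmx.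
Proof.
elim: l => [_|b l IH lok]; first by rewrite unitmxE det_mx00 unitr1.
rewrite dsum2_unit IH ?andbT; last by move=> c cl; apply: lok; right.
by have [rb okb] := lok b (or_introl erefl); apply: bmx_unit.
Qed.

(* The multiplicity of J_k(lam) in the Jordan form of the cosquare. *)
Definition jordan_mult (lam : F) k b : nat :=
  match b with
  | BJ0 _ => 0
  | BPair n mu => (n == k) * ((mu == lam) + (mu == lam^-1))
  | BSq n => (n == k) * (1 == lam)
  end.

(** As a function of [i], the truncated difference [n - i] bends only at [i = n], so second
    differences of ranks count Jordan blocks of one size. *)
Lemma cosq_rank_bmx lam b j : lam != 0 -> is_reg b -> blk_ok b ->
  (cosq_rank (bmx S b) lam j + cosq_rank (bmx S b) lam j.+2 =
  cosq_rank (bmx S b) lam j.+1 + cosq_rank (bmx S b) lam j.+1 +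
  jordan_mult lam j.+1 b)%N.
Proof.
move=> lam0; case: b => [n|n mu|n] //= _ [n0 h].
  rewrite !cosq_rank_pairmx //.
  by case: (mu == lam); case: (mu == lam^-1); case: (ltngtP n j.+1) => [||->] /=;
    lia.
have Sn := S_sqrtT h; rewrite !cosq_rank_sqrtT //.
by case: (1 == lam); case: (ltngtP n j.+1) => [||->] /=;
    lia.
Qed.

Lemma cosq_rank_dsum lam l j : lam != 0 ->
  (forall b, List.In b l -> is_reg b /\ blk_ok b) ->
  (cosq_rank (dsum S l) lam j + cosq_rank (dsum S l) lam j.+2 =
  cosq_rank (dsum S l) lam j.+1 + cosq_rank (dsum S l) lam j.+1 +
  sumn [seq jordan_mult lam j.+1 b | b <- l])%N.
Proof.
move=> lam0; elim: l => [_|b l IH lok].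
  by rewrite /cosq_rank !(flatmx0 (shift _ _ ^+ _)) !mxrank0.
have [rb okb] := lok b (or_introl erefl).
have lok' c : List.In c l -> is_reg c /\ blk_ok c by move=> cl; apply: lok; right.
have lu := dsum_unit lok'; have bu := bmx_unit rb okb.
rewrite ![cosq_rank (dsum S (b :: l)) _ _](cosq_rank_dsum2 _ _ bu lu).
by have := cosq_rank_bmx j lam0 rb okb; have := IH lok'; rewrite /=; lia.
Qed.

Lemma alternating_at_dsum m l : (forall b, List.In b l -> is_reg b /\ blk_ok b) ->
  alternating_at m (dsum S l) <-> ~ List.In (BSq F m.*2.+1) l.
Proof.
elim: l => [_|b l IH lok].
  by split=> [_ []|_ x _]; rewrite (thinmx0 x) bform0r.
have [rb okb] := lok b (or_introl erefl).
have lok' c : List.In c l -> is_reg c /\ blk_ok c by move=> cl; apply: lok; right.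
have lu := dsum_unit lok'; have bu := bmx_unit rb okb.
have hb : alternating_at m (bmx S b) <-> b <> BSq F m.*2.+1.
  case: b rb okb {lok bu} => [n|n mu|n] //= _ [n0 h].
    by split=> // _; apply: alternating_at_pairmx.
  rewrite (alternating_at_sqrtT char2 m h (S_sqrtT h)).
  by split=> [nm [e]|nm e]; apply: nm; rewrite e.
split.
  by case/(alternating_at_dsum2 m bu lu) => /hb bn /(IH lok') ln [].
move=> nl; apply/(alternating_at_dsum2 m bu lu); split.
  by apply/hb => e; apply: nl; left.
by apply/(IH lok') => e; apply: nl; right.
Qed.

(** In characteristic two [lam] differs from its inverse unless it is 1, so a block (ii) contributes
    at most once. *)
Lemma sum_mult_pair lam k l : lam != 0 -> lam != 1 ->
  sumn [seq jordan_mult lam k b | b <- l] = count (blk_eqv (BPair k lam)) l.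
Proof.
move=> lam0 lam1; elim: l => //= b l ->; congr (_ + _)%N.
case: b => [n|n mu|n] //=; last by rewrite [1 == _]eq_sym (negPf lam1) muln0.
rewrite [k == n]eq_sym; case: (n == k) => //=; rewrite mul1n.
have [->|//] := eqVneq mu lam; have [e|] := eqVneq lam lam^-1; last by rewrite addn0.
have : lam ^+ 2 == 1 by rewrite expr2 {2}e mulfV.
by rewrite sqrf_eq1 [- 1](oppv2 char2 (1 : F^o)) orbb (negPf lam1).
Qed.

Lemma sum_mult_1 k l :
  sumn [seq jordan_mult 1 k b | b <- l] =
  ((count (blk_eqv (BPair k 1)) l).*2 + count (blk_eqv (BSq F k)) l)%N.
Proof.
elim: l => //= b l ->; case: b => [n|n mu|n] //=.
  by rewrite invr1 orbb [k == n]eq_sym; case: (n == k); case: (mu == 1) => /=; lia.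
by rewrite eqxx [k == n]eq_sym; case: (n == k) => /=; lia.
Qed.

Lemma nonsingular_unique l1 l2 :
  (forall b, List.In b l1 -> is_reg b /\ blk_ok b) ->
  (forall b, List.In b l2 -> is_reg b /\ blk_ok b) ->
  admissible l1 -> admissible l2 -> hcong (dsum S l1) (dsum S l2) ->
  forall b, is_reg b -> blk_ok b -> count (blk_eqv b) l1 = count (blk_eqv b) l2.
Proof.
move=> ok1 ok2 adm1 adm2 h.
have u1 := dsum_unit ok1; have u2 := dsum_unit ok2.
have mult lam k : lam != 0 -> (0 < k)%N ->
    sumn [seq jordan_mult lam k b | b <- l1] = sumn [seq jordan_mult lam k b | b <- l2].
  move=> lam0; case: k => // j _.
  have := cosq_rank_dsum j lam0 ok1; have := cosq_rank_dsum j lam0 ok2.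
  by rewrite !(cosq_rank_hcong _ _ u1 h); lia.
have sq_iff m : List.In (BSq F m.*2.+1) l1 <-> List.In (BSq F m.*2.+1) l2.
  have e1 := alternating_at_dsum m ok1; have e2 := alternating_at_dsum m ok2.
  have a12 := alternating_at_hcong (m := m) u1 h.
  have a21 := alternating_at_hcong (m := m) u2 (hcong_sym h).
  have inP l : reflect (List.In (BSq F m.*2.+1) l) (has (blk_eqv (BSq F m.*2.+1)) l).
    apply: (iffP idP) => [/has_In[[//|//|n] bl /= /eqP ->] //|sl].
    by apply/has_In; exists (BSq F m.*2.+1) => //=.
  by case: (inP l1) e1; case: (inP l2) e2; tauto.
have countSq l n : count (blk_eqv (BSq F n)) l = 0%N <-> ~ List.In (BSq F n) l.
  split=> [c0 sl|nsl].
    have : has (blk_eqv (BSq F n)) l by apply/has_In; exists (BSq F n) => //=.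
    by rewrite has_count c0.
  apply/eqP; rewrite -leqn0 leqNgt -has_count; apply/negP.
  by case/has_In => -[//|//|m] sl /= /eqP e; apply: nsl; rewrite e.
have countPair l n : ~ List.In (BPair n (1 : F)) l -> count (blk_eqv (BPair n 1)) l = 0%N.
  move=> npl; apply/eqP; rewrite -leqn0 leqNgt -has_count; apply/negP.
  case/has_In => -[//|m a|//] sl /= /andP[/eqP e]; rewrite invr1 orbb => /eqP ea.
  by apply: npl; rewrite e -ea.
(* Ranks give only [2p + q] for [p] blocks (ii) and [q] blocks (iii). For even [k], [q] is zero; for
   odd [k], [sq_iff] and admissibility make [p] vanish in both lists or [q] vanish in both. *)
have one k : (0 < k)%N -> count (blk_eqv (BPair k 1)) l1 = count (blk_eqv (BPair k 1)) l2 /\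
    count (blk_eqv (BSq F k)) l1 = count (blk_eqv (BSq F k)) l2.
  move=> k0; have := mult 1 k (oner_neq0 _) k0; rewrite !sum_mult_1.
  have evenSq l : (forall b, List.In b l -> is_reg b /\ blk_ok b) -> ~~ odd k ->
      count (blk_eqv (BSq F k)) l = 0%N.
    by move=> okl ek; apply/countSq => /okl[_ [_]]; rewrite (negPf ek).
  have [ok|ek] := boolP (odd k); last by rewrite !evenSq //; lia.
  have kE : k = (k./2).*2.+1 by lia.
  have [s1|s1] : List.In (BSq F k) l1 \/ ~ List.In (BSq F k) l1.
    case: (posnP (count (blk_eqv (BSq F k)) l1)) => [/countSq|]; first by right.
    by rewrite -has_count => /has_In[[//|//|m] sl /= /eqP ->]; left.
    have s2 : List.In (BSq F k) l2 by rewrite kE; apply/sq_iff; rewrite -kE.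
    by rewrite !countPair; [lia | case: adm2 => _; apply | case: adm1 => _; apply].
  have s2 : ~ List.In (BSq F k) l2 by rewrite kE => /sq_iff; rewrite -kE.
  by move/countSq: s1 => ->; move/countSq: s2 => ->; lia.
case=> [//|n a|n] _ [n0 h']; last by case: (one n n0).
have [->|a1] := eqVneq a 1; first by case: (one n n0).
by rewrite -!sum_mult_pair //; apply: mult.
Qed.

Lemma blocks_unique l1 l2 : admissible l1 -> admissible l2 ->
  hcong (dsum S l1) (dsum S l2) -> blocks_equiv l1 l2.
Proof.
move=> adm1 adm2 h.
have split_l l : hcong (dsum2 (jsum S (zero_sizes l)) (dsum S (filter (@is_reg F) l)))
    (dsum S l).
  apply: hcong_sym; apply: hcong_trans (dsum_perm S (perm_zero_reg l)) _.
  exact: dsum_cat.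
have inF l b : List.In b (filter (@is_reg F) l) -> List.In b l /\ is_reg b.
  elim: l => //= c l IH; case: ifP => [rc|_]; last by move=> /IH[]; auto.
  by case=> [<-|/IH[]]; auto.
have okF l : admissible l ->
    forall b, List.In b (filter (@is_reg F) l) -> is_reg b /\ blk_ok b.
  by case=> okl _ b /inF[bl rb]; split=> //; apply: okl.
have admF l : admissible l -> admissible (filter (@is_reg F) l).
  case=> okl sep; split=> [b /inF[bl _]|n on /inF[sl _] /inF[pl _]]; first exact: okl.
  exact: sep on sl pl.
have u1 := dsum_unit (okF _ adm1); have u2 := dsum_unit (okF _ adm2).
have [zs hr] := regularization_uniq u1 u2
  (hcong_trans (split_l l1) (hcong_trans h (hcong_sym (split_l l2)))).
have reg := nonsingular_unique (okF _ adm1) (okF _ adm2) (admF _ adm1) (admF _ adm2) hr.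
apply: count_blocks_equiv; [by case: adm2 | by case: adm1 |].
move=> b okb; have [rb|] := boolP (is_reg b); first last.
  by case: b okb => // n n0 _; rewrite !count_zero_sizes; apply: zs.
by rewrite (count_reg l1 rb) (count_reg l2 rb); apply: reg.
Qed.

End Uniqueness.

(** * The matrices Gamma' *)

Section GammaBlock.
Variable F : closedFieldType.
Hypothesis char2 : (2 \in [pchar F])%N.

(** Used to show that the last basis vector is cyclic for [gamma_shift n]. *)
Lemma exp_subdiagonal n (L : 'M[F]_n) :
  (forall i j : 'I_n, (i <= j)%N -> L i j = 0) ->
  (forall i j : 'I_n, i = j.+1 :> nat -> L i j = 1) ->
  forall k (i j : 'I_n), ((i < j + k)%N -> (L ^+ k) i j = 0) /\
    (i = (j + k)%N :> nat -> (L ^+ k) i j = 1).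
Proof.
move=> L0 L1; elim=> [|k IH] i j.
  rewrite expmx0 addn0 !mxE; split=> [ij | /val_inj ->]; last by rewrite eqxx.
  by rewrite -val_eqE ltn_eqF.
rewrite expmxSr mxE; split=> ij.
  rewrite big1 // => a _; have [aj|ja] := leqP a j; first by rewrite L0 ?mulr0.
  by rewrite (IH i a).1 ?mul0r //; lia.
have jn : (j.+1 < n)%N by have := ltn_ord i; lia.
rewrite (bigD1 (Ordinal jn)) //= (IH _ _).2 /=; last by rewrite ij; lia.
rewrite mul1r L1 //= big1 ?addr0 // => a; rewrite -val_eqE /= => aj.
have [aj'|ja] := leqP a j; first by rewrite L0 ?mulr0.
by rewrite (IH i a).1 ?mul0r //; lia.
Qed.

(* The matrix [asym (Gamma' F n) - 1], found by back substitution. *)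
Definition gamma_shift n : 'M[F]_n :=
  \matrix_(i, j) (if ((j < i) && ((j.+1 == i) || (n./2 <= j)))%N then 1 else 0).

(** Reversing the rows makes the matrix upper unitriangular. *)
Lemma Gamma_unit n : odd n -> Gamma' F n \in unitmx.
Proof.
move=> on; suff : exchange F n *m Gamma' F n \in unitmx.
  by rewrite unitmx_mul => /andP[].
have E i j : (exchange F n *m Gamma' F n) i j = Gamma' F n (rev_ord i) j.
  rewrite mxE (bigD1 (rev_ord i)) //= big1 ?addr0 => [|k].
    rewrite mxE (_ : _ == n) ?mul1r //=; have := ltn_ord i; lia.
  rewrite -val_eqE !mxE /= => ki; rewrite [_ == n]negbTE ?mul0r //.
  by have := ltn_ord i; lia.
rewrite -unitmx_tr unitmxE det_trig.
  rewrite big1 ?unitr1 // => i _; rewrite mxE E mxE /= ifT //.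
  by apply/orP; left; have := ltn_ord i; lia.
apply/is_trig_mxP=> i j ij; rewrite mxE E mxE /= ifF //.
by have := ltn_ord j; have := ltn_ord i; lia.
Qed.

Lemma gamma_shift_mul n : odd n ->
  gamma_shift n *m Gamma' F n = (Gamma' F n)^T - Gamma' F n.
Proof.
(* Column [c] of [Gamma' F n] is supported in the rows [n - 1 - c] and, for [c > 0], [n - c]; these
   two terms of the product are isolated. *)
move=> on; apply/matrixP=> i c; rewrite [LHS]mxE (bigD1 (rev_ord c)) //=.
have in_ := ltn_ord i; have cn := ltn_ord c; have nE := odd_double_half n.
rewrite on /= in nE.
have [c0|c0] := posnP c.
  rewrite big1 => [|j]; last first.
    rewrite -val_eqE /= => jc; rewrite [X in _ * X]mxE ifF ?mulr0 //.
    by have := ltn_ord j; lia.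
  rewrite !mxE /=; do ?case: ifP => ?; rewrite ?(mulr0, mul0r, addr0, subrr) //; lia.
have jn : (n - c < n)%N by lia.
rewrite (bigD1 (Ordinal jn)) /=; last by rewrite -val_eqE /=; lia.
rewrite big1 => [|j /andP[]]; last first.
  rewrite -!val_eqE /= => j1 j2; rewrite [X in _ * X]mxE ifF ?mulr0 //.
  by have := ltn_ord j; lia.
rewrite addr0 !mxE /=.
have two : 1 + 1 = 0 :> F by apply: addff2.
have opp1 : - 1 = 1 :> F by apply: (oppv2 char2 (1 : F^o)).
have [lt|gt|eq] := ltngtP (i + c)%N n;
  do 6!(case: ifP => ?; try (exfalso; lia));
  by rewrite ?(mulr0, mulr1, addr0, add0r, subrr, subr0, sub0r, oppr0, two, opp1).
Qed.

Lemma Gamma_sqrtT n : odd n -> sqrtT_like (Gamma' F n).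
Proof.
move=> on; have Gu := Gamma_unit on; split=> //.
set G := Gamma' F n in Gu *.
have NE : asym G - 1%:M = gamma_shift n.
  apply: (can_inj (mulmxK Gu)); rewrite gamma_shift_mul // mulmxBl mul1mx.
  by rewrite (asym_mul Gu).
have L0 (i j : 'I_n) : (i <= j)%N -> gamma_shift n i j = 0.
  by move=> ij; rewrite mxE ltnNge ij.
have L1 (i j : 'I_n) : i = j.+1 :> nat -> gamma_shift n i j = 1.
  by move=> ij; rewrite mxE ij ltnSn eqxx.
have n0 : (0 < n)%N by case: n on {Gu G NE L0 L1}.
have pn : (n.-1 < n)%N by lia.
have entry := exp_subdiagonal L0 L1.
(* The chain of the last basis vector has unitriangular coordinates, hence is a Jordan basis for
   [asym G]. *)
pose x : 'rV[F]_n := delta_mx 0 (Ordinal pn).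
pose X : 'M[F]_n := \matrix_(i < n) (x *m (asym G - 1%:M) ^+ (n.-1 - i)).
have XE i j : X i j = (gamma_shift n ^+ (n.-1 - i)) (Ordinal pn) j.
  by rewrite mxE NE -rowE mxE.
have Xu : X \in unitmx.
  rewrite unitmxE det_trig.
    rewrite big1 ?unitr1 // => i _; rewrite XE (entry _ _ _).2 //=.
    by have := ltn_ord i; lia.
  apply/is_trig_mxP=> i j ij; rewrite XE (entry _ _ _).1 //=.
  by have := ltn_ord j; lia.
have XL : X *m asym G = (jordan n 1)^T *m X.
  apply: (jordan_chain (x := x)); last by move=> i; rewrite rowK.
  rewrite NE; apply/rowP=> j; rewrite -rowE !mxE (entry _ _ _).1 //=.
  by have := ltn_ord j; lia.
have XTu : X^T \in unitmx by rewrite unitmx_tr.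
exists X^T; split=> //; apply: trmx_inj.
rewrite !trmx_mul trmx_inv trmxK; apply: (can_inj (mulmxK Xu)).
by rewrite trmxK trmx_inv trmxK -/(asym G) (mulmxA X) mulmxKV // XL.
Qed.

End GammaBlock.

Theorem theorem2p1 (F : closedFieldType) (char2 : (2 \in [pchar F])%N) :
  (* Gamma'_n is a valid choice for block (iii) *)
  (forall n : nat, odd n -> sqrtT_like (Gamma' F n)) /\
  (* any two nonsingular matrices with cosquare similar to J_n(1) are congruent *)
  (forall (n : nat) (A B : 'M[F]_n), odd n ->
     sqrtT_like A -> sqrtT_like B -> congruent A B) /\
  (* canonical form, for any choice S n of the block (iii) *)
  (forall S : forall n : nat, 'M[F]_n,
     (forall n : nat, odd n -> sqrtT_like (S n)) ->
     forall (n : nat) (A : 'M[F]_n),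
       (exists l : seq (blk F), admissible l /\
          exists e : total_size l = n, congruent (castmx (e, e) (dsum S l)) A) /\
       (forall (l1 l2 : seq (blk F)) (e1 : total_size l1 = n) (e2 : total_size l2 = n),
          admissible l1 -> admissible l2 ->
          congruent (castmx (e1, e1) (dsum S l1)) A ->
          congruent (castmx (e2, e2) (dsum S l2)) A ->
          blocks_equiv l1 l2)).
Proof.
split; first by move=> n; apply: Gamma_sqrtT.
split; first by move=> n A B; apply: sqrtT_congruent.
move=> S S_sqrtT n A; split.
  have [l adm h] := admissible_exists char2 S_sqrtT A.
  by exists l; split=> //; exists (hcong_size h); apply/hcong_castmx.
move=> l1 l2 e1 e2 adm1 adm2 /hcong_castmx h1 /hcong_castmx h2.
apply: (blocks_unique char2 S_sqrtT) => //.
exact: hcong_trans h1 (hcong_sym h2).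
Qed.
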